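(* Let $R$ be an associative unital ring, let $n\geq 0$ be an integer, and let $\mathcal{F}_n$ be the class of all right $R$-modules of flat dimension $\leq n$. Let $\mathcal{M}$ be either the class of all embeddings, the class of all RD-embeddings, or the class of all pure embeddings of right $R$-modules. Then $(\mathcal{F}_n,\leq_{\mathcal{M}})$ is stable.
   Context: Modules are right $R$-modules; $\|M\|$ denotes the cardinality of a module $M$. An embedding is a monomorphism. A submodule $N$ of $M$ is an RD-submodule if $N\cap Mr=Nr$ for all $r\in R$; it is a pure submodule if every finite system of $R$-linear equations with right-hand side in $N$ that is solvable in $M$ is solvable in $N$. An RD-embedding (pure embedding) is a monomorphism whose image is an RD-submodule (pure submodule) of its codomain. Let $\mathcal{A}$ be a class of modules closed under isomorphism. For $A,B\in\mathcal{A}$, $A\leq_{\mathcal{M}}B$ means that $A$ is a submodule of $B$ and the inclusion is in $\mathcal{M}$. Write $\mathbf{A}=(\mathcal{A},\leq_{\mathcal{M}})$. An $\mathbf{A}$-embedding is a monomorphism $f:A\to B$ with $A,B\in\mathcal{A}$ and $f(A)\leq_{\mathcal{M}}B$. $\operatorname{LS}(\mathbf{A})$ is the least infinite cardinal $\lambda\geq\operatorname{card}(R)$ such that whenever $A$ is a submodule of $B\in\mathcal{A}$ there is $A'\in\mathcal{A}$ with $A\subseteq A'\leq_{\mathcal{M}}B$ and $\|A'\|\leq\|A\|+\lambda$. Galois types: consider triples $(\bar b,A,N)$ with $N\in\mathcal{A}$, $A$ a submodule of $N$, and $\bar b$ a (possibly infinite) tuple of elements of $N$. Triples $(\bar b_1,A_1,N_1),(\bar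 b_2,A_2,N_2)$ are atomically related if $A_1=A_2=:A$ and there are $N\in\mathcal{A}$ and $\mathbf{A}$-embeddings $f_i:N_i\to N$ ($i=1,2$) restricting to the identity on $A$ with $f_1(\bar b_1)=f_2(\bar b_2)$. Let $E^{\mathbf{A}}$ be the transitive closure of this relation; $\mathbf{gtp}_{\mathbf{A}}(\bar b/A;N)$ is the $E^{\mathbf{A}}$-class of $(\bar b,A,N)$. For $M\in\mathcal{A}$, $\mathbf{gS}_{\mathbf{A}}(M)=\{\mathbf{gtp}_{\mathbf{A}}(b/M;N)\mid M\leq_{\mathcal{M}}N\in\mathcal{A},\ b\in N\text{ a single element}\}$. $\mathbf{A}$ is stable in $\lambda$ if $|\mathbf{gS}_{\mathbf{A}}(M)|\leq\lambda$ for every $M\in\mathcal{A}$ with $\|M\|=\lambda$; $\mathbf{A}$ is stable if it is stable in $\lambda$ for some cardinal $\lambda\geq\operatorname{LS}(\mathbf{A})$. *)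

(* Defs.v *)
From HB Require Import structures.
From Stdlib Require Import Relation_Operators.
From mathcomp Require Import all_boot all_algebra generic_quotient.
From mathcomp Require Import ring_quotient.
From mathcomp Require Import boolp classical_sets functions cardinality.
From mathcomp.multinomials Require Import freeg.

Set Implicit Arguments.
Unset Strict Implicit.
Unset Printing Implicit Defensive.

Import GRing.Theory.

Local Open Scope classical_set_scope.
Local Open Scope card_scope.
Local Open Scope ring_scope.
Local Open Scope quotient_scope.

(* A right module over R is a left module over the converse ring R^c: the
   element "x r" is written r *: x. *)
Notation rmodType R := (lmodType R^c).

(* Cardinals are presented by types, up to equipotence. They are restricted to
   the universe of the carriers of modules, so that quantifying over cardinals
   has the same meaning as in set theory, where there is just one universe: a
   larger type would never be equipotent to a module. *)
Definition card_type := Type@{GRing.Lmodule.axioms_.u0}.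

Section Tensor.
Variables (R : pzRingType) (M : rmodType R) (A : lmodType R).

(* The subgroup of the free abelian group on M * A whose quotient is the tensor
   product over R. *)
Inductive tensor_rel : {freeg (M * A)} -> Prop :=
| tensor_rel0 : tensor_rel 0
| tensor_relB u v : tensor_rel u -> tensor_rel v -> tensor_rel (u - v)
| tensor_rel_addl x y a :
    tensor_rel (<< (x + y, a) >> - << (x, a) >> - << (y, a) >>)
| tensor_rel_addr x a b :
    tensor_rel (<< (x, a + b) >> - << (x, a) >> - << (x, b) >>)
| tensor_rel_scale x (r : R) a :
    tensor_rel (<< ((r : R^c) *: x, a) >> - << (x, r *: a) >>).

Definition tensor_relb : {pred {freeg (M * A)}} :=
  [pred u | `[< tensor_rel u >]].

Fact tensor_relb_closed : zmod_closed tensor_relb.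
Proof.
split; first exact/asboolP/tensor_rel0.
by move=> u v /asboolP hu /asboolP hv; apply/asboolP/tensor_relB.
Qed.

HB.instance Definition _ :=
  GRing.isZmodClosed.Build {freeg (M * A)} tensor_relb tensor_relb_closed.

Definition tensor : zmodType := Quotient.quot tensor_relb.

Definition tens (x : M) (a : A) : tensor := \pi_tensor << (x, a) >>.

End Tensor.

Section TensorTheory.
Variables (R : pzRingType) (M : rmodType R) (A : lmodType R).

Lemma tens_eq (u v : {freeg (M * A)}) :
  \pi_(tensor M A) u = \pi_(tensor M A) v <-> tensor_rel (u - v).
Proof.
split=> [/eqP|h]; last apply/eqP; rewrite -Quotient.idealrBE.
  by move/asboolP.
exact/asboolP.
Qed.

Lemma tensDl (x y : M) (a : A) : tens (x + y) a = tens x a + tens y a.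
Proof.
rewrite /tens -[RHS]raddfD; apply/tens_eq.
by rewrite opprD addrA; apply: tensor_rel_addl.
Qed.

Lemma tensDr (x : M) (a b : A) : tens x (a + b) = tens x a + tens x b.
Proof.
rewrite /tens -[RHS]raddfD; apply/tens_eq.
by rewrite opprD addrA; apply: tensor_rel_addr.
Qed.

Lemma tensZ (x : M) (r : R) (a : A) : tens ((r : R^c) *: x) a = tens x (r *: a).
Proof. exact/tens_eq/tensor_rel_scale. Qed.

End TensorTheory.

Section TensorMap.
Variables (R : pzRingType) (M : rmodType R) (A B : lmodType R).
Variable f : {linear A -> B}.

Definition freeg_map (u : {freeg (M * A)}) : {freeg (M * B)} :=
  fglift (fun p => << (p.1, f p.2) >>) u.

Definition tensor_map (t : tensor M A) : tensor M B :=
  \pi_(tensor M B) (freeg_map (repr t)).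

Fact freeg_mapB : {morph freeg_map : u v / u - v}.
Proof. exact: lift_is_additive. Qed.

Fact freeg_map1 x a : freeg_map << (x, a) >> = << (x, f a) >>.
Proof. by rewrite /freeg_map liftU scale1r. Qed.

Fact freeg_map_rel u : tensor_rel u -> tensor_rel (freeg_map u).
Proof.
elim=> [|v w _ hv _ hw|x y a|x a b|x r a].
- by rewrite -(subrr 0) freeg_mapB subrr; apply: tensor_rel0.
- by rewrite freeg_mapB; apply: tensor_relB.
- by rewrite !freeg_mapB !freeg_map1; apply: tensor_rel_addl.
- by rewrite !freeg_mapB !freeg_map1 linearD; apply: tensor_rel_addr.
- by rewrite !freeg_mapB !freeg_map1 linearZ; apply: tensor_rel_scale.
Qed.

Lemma tensor_map_pi u :
  tensor_map (\pi_(tensor M A) u) = \pi_(tensor M B) (freeg_map u).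
Proof.
by apply/tens_eq; rewrite -freeg_mapB; apply/freeg_map_rel/tens_eq; rewrite reprK.
Qed.

Lemma tensor_map_tens x a : tensor_map (tens x a) = tens x (f a).
Proof. by rewrite /tens tensor_map_pi freeg_map1. Qed.

Lemma tensor_mapB : {morph tensor_map : s t / s - t}.
Proof.
move=> s t; rewrite -[s]reprK -[t]reprK -raddfB !tensor_map_pi.
by rewrite freeg_mapB raddfB.
Qed.

End TensorMap.

Section FlatDimension.
Variable R : pzRingType.

Definition flat (M : rmodType R) : Prop :=
  forall (A B : lmodType R) (f : {linear A -> B}),
    injective f -> injective (@tensor_map R M A B f).

(* There is an exact sequence 0 -> F_n -> ... -> F_0 -> M -> 0 with all F_i
   flat. It is extended by zero modules in the degrees above n. *)
Definition flat_dim_le (n : nat) (M : rmodType R) : Prop :=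
  exists (F : nat -> rmodType R) (d : forall i, {linear F i.+1 -> F i})
         (e : {linear F 0%N -> M}),
    [/\ forall i, flat (F i),
        forall i, (n < i)%N -> forall x : F i, x = 0,
        range e = [set: M],
        range (d 0%N) = [set x | e x = 0] &
        forall i, range (d i.+1) = [set x | d i x = 0]].

End FlatDimension.

Section Embeddings.
Variable R : pzRingType.
Implicit Types M N : rmodType R.

Definition is_submodule M (S : set M) : Prop :=
  S 0 /\ forall (r : R^c) x y, S x -> S y -> S (r *: x + y).

Definition RD_sub M (S : set M) : Prop :=
  forall r : R^c, S `&` range (fun x : M => r *: x) = [set r *: x | x in S].

(* The system has m equations sum_j x_j a_ij = c_i in k unknowns. *)
Definition pure_sub M (S : set M) : Prop :=
  forall (m k : nat) (a : 'I_m -> 'I_k -> R^c) (c : 'I_m -> M),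
    (forall i, S (c i)) ->
    (exists x : 'I_k -> M, forall i, \sum_(j < k) a i j *: x j = c i) ->
    exists2 x : 'I_k -> M,
      (forall j, S (x j)) & forall i, \sum_(j < k) a i j *: x j = c i.

Definition embedding M N (f : {linear M -> N}) : Prop := injective f.

Definition RD_embedding M N (f : {linear M -> N}) : Prop :=
  injective f /\ RD_sub (range f).

Definition pure_embedding M N (f : {linear M -> N}) : Prop :=
  injective f /\ pure_sub (range f).

End Embeddings.

(* A submodule of N is presented by a module A together with a monomorphism
   A -> N, and A is identified with its image. Both the class of modules and the
   class of morphisms are meant to be closed under isomorphism. *)
Section AbstractClass.
Variable R : pzRingType.
Variable cls : rmodType R -> Prop.
Variable mor : forall M N : rmodType R, {linear M -> N} -> Prop.

Definition A_embedding (M N : rmodType R) (f : {linear M -> N}) : Prop :=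
  [/\ cls M, cls N, injective f & mor f].

Section LowenheimSkolem.

Definition LS_bound (L : card_type) : Prop :=
  [/\ infinite_set [set: L], [set: R] #<= [set: L] &
      forall (B : rmodType R) (A : set B), cls B -> is_submodule A ->
        exists (A' : rmodType R) (i : {linear A' -> B}),
          [/\ A_embedding i, A `<=` range i & [set: A'] #<= [set: (A + L)%type]]].

Definition is_LS (L : card_type) : Prop :=
  LS_bound L /\ forall L' : card_type, LS_bound L' -> [set: L] #<= [set: L'].

End LowenheimSkolem.

Section GaloisTypes.
Variables (I : Type) (A : rmodType R).

(* A triple (b, A, N), with A and the index set I of the tuple b fixed. *)
Record triple := Triple {
  tr_mod : rmodType R;
  tr_cls : cls tr_mod;
  tr_incl : {linear A -> tr_mod};
  tr_inj : injective tr_incl;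
  tr_tuple : I -> tr_mod
}.

(* The condition f1 o incl1 = f2 o incl2 says that, once A is identified with
   its image in N, both f1 and f2 restrict to the identity on A. *)
Definition atomically_related (t1 t2 : triple) : Prop :=
  exists (N : rmodType R) (f1 : {linear tr_mod t1 -> N})
         (f2 : {linear tr_mod t2 -> N}),
    [/\ A_embedding f1, A_embedding f2,
        forall a, f1 (tr_incl t1 a) = f2 (tr_incl t2 a) &
        forall i, f1 (tr_tuple t1 i) = f2 (tr_tuple t2 i)].

Definition type_equiv : triple -> triple -> Prop :=
  clos_trans triple atomically_related.

Definition gtp (t : triple) : triple -> Prop := type_equiv t.

End GaloisTypes.

(* The triples form a large type, out of the reach of the universe in which the
   library sets and their cardinalities live. Hence sets of triples are plain
   predicates, and |gS M| <= |L| is spelled out as an injection into L. *)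
Definition gS (M : rmodType R) (p : triple unit M -> Prop) : Prop :=
  exists2 t : triple unit M, A_embedding (tr_incl t) & p = gtp t.

Definition stable_in (L : card_type) : Prop :=
  forall M : rmodType R, cls M -> [set: M] #= [set: L] ->
    exists f : (triple unit M -> Prop) -> L,
      forall p q, gS p -> gS q -> f p = f q -> p = q.

Definition stable : Prop :=
  exists LS L : card_type,
    [/\ is_LS LS, [set: LS] #<= [set: L] & stable_in L].

End AbstractClass.

(* Main.v *)
From HB Require Import structures.
From Stdlib Require Import FunctionalExtensionality Relation_Operators.
Require Import Defs.
From mathcomp Require Import all_boot all_algebra generic_quotient.
From mathcomp Require Import ring_quotient.
From mathcomp Require Import boolp classical_sets functions cardinality.
From mathcomp.multinomials Require Import freeg.

Set Implicit Arguments.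
Unset Strict Implicit.
Unset Printing Implicit Defensive.

Import GRing.Theory.
Local Open Scope classical_set_scope.
Local Open Scope card_scope.

(** A pushout of two extensions of M may have flat dimension n + 1, hence is not an
    amalgam in general. Types are counted without amalgamation. Let M <= N be of
    flat dimension at most n, and let b be an element of N. Put the class of b into
    a pure submodule of N / M of cardinality at most card R + aleph_0, and let Y be
    its preimage in N. Then
    - Y has flat dimension at most n. Pure quotients do not raise the flat
      dimension, so N / Y, like N / M, has flat dimension at most n + 1, and the
      long exact sequence of 0 -> Y -> N -> N / Y -> 0 gives the bound for Y
      ([tor_zero_of_relatively_pure]).
    - The inclusion of Y in N belongs to the same class of embeddings as that of M
      in N ([embedding_inherited], [RD_inherited], [pure_inherited]).
    Hence N can be replaced by Y in the triple (b, M, N). Moreover Y is M plus a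
    small set of the values of terms at b, so the triple (b, M, Y) is determined up
    to isomorphism by the linear relations between these values modulo M, which
    form a function from a set of cardinality kappa = card R + aleph_0 to M
    extended by one point ([same_code_type_equiv]). If M has cardinality
    2 ^ kappa, there are 2 ^ kappa such functions: this is stability in
    2 ^ kappa ([stable_in_powerset]). With M = 0, the same construction shows that the
    Loewenheim-Skolem number is kappa ([LS_bound_kappa], [is_LS_kappa]); its cardinal
    arithmetic, and that of the count, rests on T * T embedding in T for every
    infinite T ([embeds_square]).

    The homological algebra is done with elements. A free resolution of a left
    module is a sequence of row-finite matrices, and its tensor product with a
    right module M is a complex of finitely supported families of elements of M.
    Flat dimension at most n is the vanishing of the homology in degree n + 1 of
    all these complexes ([flat_dim_leP]), a condition to which purity applies
    directly, because a family involves finitely many equations only. Quotient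
    modules N / U are avoided by working with cycles and boundaries modulo U. *)

(** * Cardinal arithmetic *)

Definition embeds (A B : Type) : Prop := exists f : A -> B, injective f.

Lemma embeds_refl A : embeds A A.
Proof. by exists id. Qed.

Lemma embeds_trans B A C : embeds A B -> embeds B C -> embeds A C.
Proof. by move=> [f fI] [g gI]; exists (g \o f); apply: inj_comp. Qed.

Lemma embeds_prod A A' B B' : embeds A A' -> embeds B B' -> embeds (A * B) (A' * B').
Proof.
move=> [f fI] [g gI]; exists (fun p => (f p.1, g p.2)).
by move=> [a b] [a' b'] [/fI -> /gI ->].
Qed.

Lemma embeds_sum A A' B B' : embeds A A' -> embeds B B' -> embeds (A + B) (A' + B').
Proof.
move=> [f fI] [g gI].
exists (fun s => match s with inl a => inl (f a) | inr b => inr (g b) end).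
by move=> [a|b] [a'|b'] //= [] => [/fI|/gI] ->.
Qed.

Lemma embeds_card_le A B : embeds A B <-> [set: A] #<= [set: B].
Proof.
split=> [[f fI]|/card_leP[f]].
  apply: inj_card_le; have /Pinj[g _] : {in [set: A] &, injective f}.
    by move=> x y _ _; apply: fI.
  exact: ('totalfun_[set: A] g).
exists (fun a => val (f (SigSub (mem_set (I : [set: A] a))))).
by move=> a b /val_inj /(@inj _ _ _ f) h; have := h (mem_set I) (mem_set I) => -[].
Qed.

Lemma infinite_embeds T : infinite_set [set: T] <-> embeds nat T.
Proof. by rewrite embeds_card_le; apply: infiniteP. Qed.

(** A maximal matching between A and B exhausts one of them. *)
Lemma set_embeds_total T (A B : set T) :
  (exists f : T -> T, (forall x, A x -> B (f x)) /\ {in A &, injective f}) \/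
  (exists f : T -> T, (forall x, B x -> A (f x)) /\ {in B &, injective f}).
Proof.
pose P (G : set (T * T)) :=
  [/\ forall p, G p -> A p.1 /\ B p.2,
      forall x y y', G (x, y) -> G (x, y') -> y = y' &
      forall x x' y, G (x, y) -> G (x', y) -> x = x'].
have [|G [[GAB Gf Gi] Gmax]] := @Zorn_bigcup _ P.
  move=> F FP Ftot.
  have dir p q : (\bigcup_(X in F) X) p -> (\bigcup_(X in F) X) q ->
      exists2 X, F X & X p /\ X q.
    move=> [X FX Xp] [Y FY Yq].
    by have [XY|YX] := Ftot _ _ FX FY;
      [exists Y => //; split=> //; exact: XY|exists X => //; split=> //; exact: YX].
  split=> [p [X FX Xp]|x y y' h h'|x x' y h h'].
  - by have [h _ _] := FP _ FX; apply: h.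
  - by have [X /FP[_ f _] [a b]] := dir _ _ h h'; apply: f a b.
  - by have [X /FP[_ _ f] [a b]] := dir _ _ h h'; apply: f a b.
have [hA|hA] := pselect (forall x, A x -> exists y, G (x, y)).
  left; have /choice[f fP] : forall x, exists y, A x -> G (x, y).
    by move=> x; have [/hA[y]|] := pselect (A x); [exists y|exists x].
  exists f; split=> [x /fP/GAB[]//|x x' /set_mem/fP h /set_mem/fP h' e].
  by apply: (Gi _ _ (f x)) => //; rewrite e.
have [x0 [Ax0 nx0]] : exists x, A x /\ forall y, ~ G (x, y).
  by move/existsNP: hA => [x /not_implyP[Ax /forallNP h]]; exists x.
have hB y : B y -> exists x, G (x, y).
  move=> By; apply: contrapT => /forallNP ny.
  apply: (Gmax (G `|` [set (x0, y)])).
    split; first by left.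
    by move=> /(_ (x0, y)) h; apply/(nx0 y)/h; right.
  split.
  - by move=> p [/GAB//|->].
  - move=> x z z' [h|[ex ->]] [h'|[ex' ->]] //; first exact: Gf _ _ _ h h'.
      by case: (nx0 z); rewrite -ex'.
    by case: (nx0 z'); rewrite -ex.
  - move=> x x' z [h|[-> ez]] [h'|[-> ez']] //; first exact: Gi _ _ _ h h'.
      by case: (ny x); rewrite -ez'.
    by case: (ny x'); rewrite -ez.
right; have /choice[f fP] : forall y, exists x, B y -> G (x, y).
  by move=> y; have [/hB[x]|] := pselect (B y); [exists x|exists x0].
exists f; split=> [y /fP/GAB[]//|y y' /set_mem/fP h /set_mem/fP h' e].
by apply: (Gf (f y)) => //; rewrite e.
Qed.

Section SelfProduct.
Variable T : Type.

(** The set D on which a graph G of a partial map from T * T to T is meant to be an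
    injection of D * D into D. *)
Definition pairing_dom (G : set (T * T * T)) : set T := [set x | exists z, G ((x, x), z)].

Record pairing (G : set (T * T * T)) : Prop := Pairing {
  pairing_fun : forall p z z', G (p, z) -> G (p, z') -> z = z';
  pairing_inj : forall p p' z, G (p, z) -> G (p', z) -> p = p';
  pairing_field : forall x y z, G ((x, y), z) ->
    [/\ pairing_dom G x, pairing_dom G y & pairing_dom G z];
  pairing_total : forall x y, pairing_dom G x -> pairing_dom G y -> exists z, G ((x, y), z) }.

(** The starting point of Zorn's lemma has to be infinite, since a one-element set
    is in bijection with its square and the extension step uses three labels. *)
Lemma nat_pairing : embeds nat T -> exists2 G, pairing G & embeds nat {x | pairing_dom G x}.
Proof.
move=> [e eI].
exists [set q | exists i j : nat, q = ((e i, e j), e (pickle (i, j)))]; last first.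
  have h i : pairing_dom [set q | exists i j : nat, q = ((e i, e j), e (pickle (i, j)))] (e i).
    by exists (e (pickle (i, i))), i, i.
  by exists (fun i => exist _ _ (h i)) => i j [/eI].
have fe i : pairing_dom [set q | exists i j : nat, q = ((e i, e j), e (pickle (i, j)))] (e i).
  by exists (e (pickle (i, i))), i, i.
split.
- move=> p z z' [i [j [-> ->]]] [i' [j' [/eI -> /eI -> ->]]] //.
- move=> p p' z [i [j [-> ->]]] [i' [j' [-> /eI]]].
  by move=> /(pcan_inj pickleK)[-> ->].
- by move=> x y z [i [j [-> -> ->]]].
- move=> x y [_ [i [_ [-> _ _]]]] [_ [j [_ [-> _ _]]]].
  by exists (e (pickle (i, j))), i, j.
Qed.

Lemma maximal_pairing G0 : pairing G0 ->
  exists2 G, pairing G & G0 `<=` G /\ forall H, pairing H -> G `<=` H -> H `<=` G.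
Proof.
move=> G0P.
(* adding G0 to every graph makes the empty chain harmless *)
have [|G [GP Gmax]] := @Zorn_bigcup _ [set G | pairing (G `|` G0)].
  move=> F FP Ftot; set U := \bigcup_(X in F) X.
  have dir a b : (U `|` G0) a -> (U `|` G0) b ->
      exists H, [/\ pairing H, H `<=` U `|` G0, H a & H b].
    move=> [[X FX Xa]|a0] [[Y FY Yb]|b0].
    - have [XY|YX] := Ftot _ _ FX FY.
        exists (Y `|` G0); split; [exact: FP| |by left; apply: XY|by left].
        by apply: setSU; apply: bigcup_sup.
      exists (X `|` G0); split; [exact: FP| |by left|by left; apply: YX].
      by apply: setSU; apply: bigcup_sup.
    - exists (X `|` G0); split; [exact: FP| |by left|by right].
      by apply: setSU; apply: bigcup_sup.
    - exists (Y `|` G0); split; [exact: FP| |by right|by left].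
      by apply: setSU; apply: bigcup_sup.
    - by exists G0; split=> // p; right.
  have mono H x : H `<=` U `|` G0 -> pairing_dom H x -> pairing_dom (U `|` G0) x.
    by move=> HU [z /HU h]; exists z.
  split.
  - by move=> p z z' h h'; have [H [[f _ _ _] _ a b]] := dir _ _ h h'; apply: f a b.
  - by move=> p p' z h h'; have [H [[_ f _ _] _ a b]] := dir _ _ h h'; apply: f a b.
  - move=> x y z h; have [H [[_ _ f _] HU a _]] := dir _ _ h h.
    by have [? ? ?] := f _ _ _ a; split; apply: mono HU _.
  - move=> x y [z h] [z' h']; have [H [[_ _ _ f] HU a b]] := dir _ _ h h'.
    by have [w /HU] : exists w, H (x, y, w); [apply: f; eexists; eassumption|exists w].
exists (G `|` G0); first exact: GP.
split=> [p|H HP sGH]; first by right.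
apply: contrapT => nHG; apply: (Gmax H).
  by split=> [p Gp|HG]; [apply: sGH; left|apply: nHG => p /HG; left].
by rewrite /= (_ : H `|` G0 = H) //; apply/setUidPl => p p0; apply: sGH; right.
Qed.

(** Zorn's lemma gives an injection of D * D into D for a maximal infinite subset
    D of T. If the complement of D embeds in D, then T embeds in D * D, hence in
    D; otherwise the complement contains a copy D' of D, and the new pairs of
    elements of the union of D and D' form three copies of D * D, which embed in
    D': this contradicts maximality. *)
Lemma embeds_square : embeds nat T -> embeds (T * T) T.
Proof.
move=> /nat_pairing[G0 G0P [e eI]].
have [G GP [sG0 Gmax]] := maximal_pairing G0P.
set D := pairing_dom G.
(* a sequence of labels in D *)
pose c k : T := sval (e k).
have cI : injective c.
  move=> i j h; apply: eI; move: h; rewrite /c.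
  by case: (e i) (e j) => [x ?] [y ?] /= h; apply: eq_exist.
have cD k : D (c k) by rewrite /c; case: (e k) => x [z h] /=; exists z; apply: sG0.
have /choice[f fP] : forall p, exists z, D p.1 -> D p.2 -> G (p, z).
  move=> [x y] /=; have [[Dx Dy]|h] := pselect (D x /\ D y).
    by have [z] := pairing_total GP Dx Dy; exists z.
  by exists x => Dx Dy; case: h.
have fD x y : D x -> D y -> D (f (x, y)).
  by move=> Dx Dy; have [] := pairing_field GP (fP (x, y) Dx Dy).
have fI x y x' y' : D x -> D y -> D x' -> D y' -> f (x, y) = f (x', y') ->
    x = x' /\ y = y'.
  move=> Dx Dy Dx' Dy' h; have := fP (x, y) Dx Dy; rewrite h => h1.
  by have [-> ->] := pairing_inj GP h1 (fP (x', y') Dx' Dy').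
have [[j [jD jI]]|[j [jD jI]]] := set_embeds_total (~` D) D.
  pose g x := if `[< D x >] then f (c 0%N, x) else f (c 1%N, j x).
  have gD x : D (g x).
    by rewrite /g; case: asboolP => h; apply: fD => //; apply: jD.
  have gI : injective g.
    move=> x y; rewrite /g; case: asboolP => hx; case: asboolP => hy /fI[] //; auto.
    - by move=> /cI.
    - by move=> /cI.
    - by move=> _ /jI; apply; apply: mem_set.
  exists (fun p => f (g p.1, g p.2)) => -[x y] [x' y'] /= /fI[] // /gI -> /gI -> //.
exfalso.
(* m enumerates the union of D and D', which is the image of D under j *)
pose m (b : bool) x := if b then j x else x.
have mI b x b' x' : D x -> D x' -> m b x = m b' x' -> b = b' /\ x = x'.
  move=> Dx Dx'; case: b b' => [] [] /=.
  - by move=> /jI h; split=> //; apply: h; apply: mem_set.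
  - by move=> h; case: (jD _ Dx); rewrite h.
  - by move=> h; case: (jD _ Dx'); rewrite -h.
  - by [].
(* the label k < 3 separates the three copies of D * D *)
pose k a b := if a then (if b then 0%N else 1%N) else 2%N.
pose v a b x y := if a || b then j (f (c (k a b), f (x, y))) else f (x, y).
pose H := [set q | exists a b x y, [/\ D x, D y & q = ((m a x, m b y), v a b x y)]].
have vE a b x y : D x -> D y -> exists2 z, D z & v a b x y = m (a || b) z.
  move=> Dx Dy; rewrite /v; case: (a || b) => /=.
    by exists (f (c (k a b), f (x, y))) => //; apply: (fD) => //; apply: fD.
  by exists (f (x, y)) => //; apply: fD.
have HD a x : D x -> pairing_dom H (m a x).
  by move=> Dx; exists (v a a x x), a, a, x, x.
have sGH : G `<=` H.
  move=> [[x y] z] h; have [Dx Dy _] := pairing_field GP h.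
  exists false, false, x, y; split=> //.
  by rewrite (pairing_fun GP h (fP (x, y) Dx Dy)).
have HP : pairing H.
  split.
  - move=> p z z' [a [b [x [y [Dx Dy [-> ->]]]]]].
    move=> [a' [b' [x' [y' [Dx' Dy' [e1 e2 ->]]]]]].
    by have [-> ->] := mI _ _ _ _ Dx Dx' e1; have [-> ->] := mI _ _ _ _ Dy Dy' e2.
  - move=> p p' z [a [b [x [y [Dx Dy [-> ->]]]]]].
    move=> [a' [b' [x' [y' [Dx' Dy' [-> ve]]]]]].
    have [eab] : (a || b) = (a' || b').
      have [w Dw ew] := vE a b x y Dx Dy; have [w' Dw' ew'] := vE a' b' x' y' Dx' Dy'.
      by move: ve; rewrite ew ew' => /mI[].
    move: ve; rewrite /v -eab; case: ifP => ab; last first.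
      move=> /fI[] // -> ->; move: eab ab.
      by case: (a) (b) (a') (b') => [] [] [] [].
    move=> /jI h; have {h} : f (c (k a b), f (x, y)) = f (c (k a' b'), f (x', y')).
      by apply: h; apply: mem_set; apply: (fD) => //; apply: fD.
    move=> /fI[]; auto => /cI ek /fI[] // -> ->.
    by move: ek ab eab; case: (a) (b) (a') (b') => [] [] [] [].
  - move=> _ _ _ [a [b [x [y [Dx Dy [-> -> ->]]]]]].
    have [w Dw ->] := vE a b x y Dx Dy.
    by split; apply: HD.
  - move=> _ _ [_ [a [b [x [y [Dx Dy [-> _ _]]]]]]] [_ [a' [b' [x' [y' [Dx' Dy' [-> _ _]]]]]]].
    by exists (v a a' x x'), a, a', x, x'.
have [z Hz] := HD true _ (cD 0%N).
by apply: (jD _ (cD 0%N)); exists z; apply: (Gmax _ HP sGH).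
Qed.

End SelfProduct.

Lemma embeds_seq T : embeds nat T -> embeds (seq T) T.
Proof.
move=> natT; have [g gI] := embeds_square natT; have [e eI] := natT.
pose code := foldr (fun x y => g (x, y)) (e 0%N).
apply: (@embeds_trans (T * T)); last exact: embeds_square.
(* iterated pairing is injective on the sequences of a given length *)
exists (fun s => (e (size s), code s)) => s t [/eI].
by elim: s t => [|x s IH] [|y t] //= [/IH{}IH] /gI[-> /IH ->].
Qed.

Lemma embeds_seq_mono A B : embeds A B -> embeds (seq A) (seq B).
Proof. by move=> [f fI]; exists (map f); apply: inj_map. Qed.

Lemma embeds_tree_seq A : embeds (GenTree.tree A) (seq (nat + A)).
Proof. by exists (@GenTree.encode A); apply: pcan_inj (GenTree.codeK A). Qed.

Lemma embeds_add_self T : embeds nat T -> embeds (T + T) T.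
Proof.
move=> natT; apply: embeds_trans (embeds_square natT).
have [e eI] := natT.
exists (fun s => match s with inl x => (e 0%N, x) | inr x => (e 1%N, x) end).
by move=> [x|x] [y|y] [] => [->|/eI|/eI|->].
Qed.

Lemma embeds_add A B T : embeds nat T -> embeds A T -> embeds B T -> embeds (A + B) T.
Proof.
by move=> natT AT BT; apply: embeds_trans (embeds_add_self natT); apply: embeds_sum.
Qed.

Lemma embeds_tree A T : embeds nat T -> embeds A T -> embeds (GenTree.tree A) T.
Proof.
move=> natT AT; apply: (embeds_trans (embeds_tree_seq A)).
apply: embeds_trans (embeds_seq natT).
exact/embeds_seq_mono/embeds_add.
Qed.

Lemma embeds_powerset A B : embeds A B -> embeds (A -> bool) (B -> bool).
Proof.
move=> [f fI]; exists (fun P b => `[< exists2 a, f a = b & P a >]).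
move=> P Q h; apply: functional_extensionality => a.
have := congr1 (@^~ (f a)) h => /=.
have E (X : A -> bool) : `[< exists2 a', f a' = f a & X a' >] = X a.
  by apply/asboolP/idP => [[a' /fI ->]|Xa] //; exists a.
by rewrite !E.
Qed.

(** A function to option B is coded by its graph; the argument None of the code says
    whether the value is defined. *)
Lemma embeds_fun_option A B C :
  embeds B (C -> bool) -> embeds (A -> option B) (A * option C -> bool).
Proof.
move=> [f fI].
exists (fun g p => match g p.1, p.2 with
                   | None, _ => false
                   | Some b, None => true
                   | Some b, Some c => f b c end).
move=> g h e; apply: functional_extensionality => a.
have := congr1 (@^~ (a, None)) e => /=; case ga : (g a) => [b|]; case ha : (h a) => [b'|] // _.
congr Some; apply/fI/functional_extensionality => c.
by have := congr1 (@^~ (a, Some c)) e; rewrite /= ga ha.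
Qed.

Local Open Scope ring_scope.

(** * Linear maps and submodules *)

Section Linear.
Variables (S : pzRingType) (A B : lmodType S) (f : A -> B).
Hypothesis fL : linear f.

Definition lin_of : {linear A -> B} :=
  HB.pack f (GRing.isLinear.Build S A B *:%R f fL).

Lemma lin_ofE x : lin_of x = f x. Proof. by []. Qed.
End Linear.

Record submod (S : pzRingType) (N : lmodType S) := Submod {
  submod_set :> N -> Prop;
  submodP : submod_set 0 /\
            forall (r : S) x y, submod_set x -> submod_set y -> submod_set (r *: x + y) }.

Section Submodule.
Variables (S : pzRingType) (N : lmodType S) (Y : submod N).

Definition submod_pred : {pred N} := [pred x | `[< Y x >]].

Fact submod_pred_closed : submod_closed submod_pred.
Proof.
case: (submodP Y) => Y0 YP.
by split=> [|r x y /asboolP Yx /asboolP Yy]; apply/asboolP; [|apply: YP].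
Qed.

HB.instance Definition _ := GRing.isSubmodClosed.Build S N submod_pred
  (GRing.submod_closed_semi submod_pred_closed).

Definition submod_type := {x : N | x \in submod_pred}.
HB.instance Definition _ := SubChoice.on submod_type.
HB.instance Definition _ := [SubChoice_isSubLmodule of submod_type by <:].

Definition submod_incl (x : submod_type) : N := val x.

Fact submod_incl_linear : linear submod_incl.
Proof. by move=> r x y; rewrite /submod_incl linearP. Qed.

Definition submod_inclL : {linear submod_type -> N} := lin_of submod_incl_linear.

Definition in_submod x (Yx : Y x) : submod_type := Sub x (asboolT Yx).

Lemma submod_incl_inj : injective submod_inclL.
Proof. exact: val_inj. Qed.

Lemma submod_inclP x : Y (submod_inclL x).
Proof. exact/asboolP/(valP x). Qed.

Lemma range_submod_incl : range submod_inclL = submod_set Y :> set N.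
Proof.
apply/seteqP; split=> [_ [x _ <-]|x Yx]; first exact: submod_inclP.
by exists (in_submod Yx).
Qed.

Lemma submod_opp x : Y x -> Y (- x).
Proof. by case: (submodP Y) => Y0 YP Yx; rewrite -[- x]addr0 -scaleN1r; apply: YP. Qed.

Lemma submodD x y : Y x -> Y y -> Y (x + y).
Proof. by case: (submodP Y) => Y0 YP Yx Yy; rewrite -[x]scale1r; apply: YP. Qed.

Lemma submodB x y : Y x -> Y y -> Y (x - y).
Proof. by move=> Yx Yy; apply/submodD/submod_opp. Qed.

Lemma submodZ (r : S) x : Y x -> Y (r *: x).
Proof. by case: (submodP Y) => Y0 YP Yx; rewrite -[_ *: _]addr0; apply: YP. Qed.

End Submodule.

Section Kernel.
Variables (S : pzRingType) (A B : lmodType S) (f : {linear A -> B}).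

Fact ker_closed : [set x | f x = 0] 0 /\
  forall (r : S) x y, f x = 0 -> f y = 0 -> f (r *: x + y) = 0.
Proof.
by split=> [|r x y fx fy]; rewrite /= ?linear0 // linearP fx fy scaler0 addr0.
Qed.
Definition ker_submod : submod A := Submod ker_closed.

Fact image_closed : range f 0 /\
  forall (r : S) x y, range f x -> range f y -> range f (r *: x + y).
Proof.
split=> [|r _ _ [x _ <-] [y _ <-]]; first by exists 0; rewrite ?linear0.
by exists (r *: x + y); rewrite ?linearP.
Qed.
Definition image_submod : submod B := Submod image_closed.
End Kernel.

(** * Finitely supported families *)

Section Fs.
Variables (S : pzRingType) (I : choiceType) (M : lmodType S).

Fact finsupp_closed :
  [set f : I -> M | exists s : seq I, forall i, i \notin s -> f i = 0] 0 /\
  forall (r : S) f g,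
    [set f : I -> M | exists s : seq I, forall i, i \notin s -> f i = 0] f ->
    [set f : I -> M | exists s : seq I, forall i, i \notin s -> f i = 0] g ->
    [set f : I -> M | exists s : seq I, forall i, i \notin s -> f i = 0] (r *: f + g).
Proof.
split=> [|r f g [s hs] [t ht]]; first by exists [::].
exists (s ++ t) => i; rewrite mem_cat negb_or => /andP[/hs fi /ht gi].
by have -> : (r *: f + g) i = r *: f i + g i by []; rewrite fi gi scaler0 addr0.
Qed.

(** The direct sum of copies of M indexed by I; for M the ring itself it is the free
    module on I. *)
Definition fs : Type := submod_type (Submod finsupp_closed).
HB.instance Definition _ := GRing.Lmodule.on fs.

Definition fs_fun (y : fs) : I -> M := submod_incl y.
Coercion fs_fun : fs >-> Funclass.

Lemma fs_finite (y : fs) : exists s : seq I, forall i, i \notin s -> y i = 0.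
Proof. exact: (submod_inclP y). Qed.

Definition supp (y : fs) : seq I := undup (sval (cid (fs_finite y))).

Lemma suppP (y : fs) i : i \notin supp y -> y i = 0.
Proof. by rewrite mem_undup; case: cid => s /= h /h. Qed.

Definition mk_fs (f : I -> M) (h : exists s : seq I, forall i, i \notin s -> f i = 0) : fs :=
  in_submod (Y := Submod finsupp_closed) h.

Lemma mk_fsE f h i : @mk_fs f h i = f i.
Proof. by []. Qed.

Lemma fsP (y z : fs) : (forall i, y i = z i) -> y = z.
Proof. by move=> h; apply/val_inj/functional_extensionality. Qed.

Lemma fs0 i : (0 : fs) i = 0. Proof. by []. Qed.
Lemma fsB (y z : fs) i : (y - z : fs) i = y i - z i. Proof. by []. Qed.
Lemma fsZ r (y : fs) i : (r *: y : fs) i = r *: y i. Proof. by []. Qed.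
Lemma fs_sum (K : Type) (s : seq K) (P : pred K) (F : K -> fs) i :
  (\sum_(k <- s | P k) F k : fs) i = \sum_(k <- s | P k) F k i.
Proof. by elim/big_rec2: _ => // k x y _ <-. Qed.

Fact single_finite i x :
  exists s : seq I, forall j, j \notin s -> (if j == i then x else 0) = 0 :> M.
Proof. by exists [:: i] => j; rewrite inE => /negPf ->. Qed.
Definition single i x : fs := mk_fs (single_finite i x).

Lemma singleE i x j : single i x j = if j == i then x else 0.
Proof. by []. Qed.

Lemma singleB i : {morph single i : x y / x - y}.
Proof. by move=> x y; apply: fsP => j; rewrite fsB !singleE; case: eqP; rewrite ?subr0. Qed.

Lemma fs_decomp (y : fs) : y = \sum_(i <- supp y) single i (y i).
Proof.
apply: fsP => j; rewrite fs_sum; have [js|js] := boolP (j \in supp y).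
  rewrite (bigD1_seq j) ?undup_uniq //= singleE eqxx big1 ?addr0 // => i.
  by rewrite singleE eq_sym => /negPf ->.
rewrite suppP // big_seq big1 // => i /= si; rewrite singleE.
by case: eqP => // ji; rewrite -ji (negPf js) in si.
Qed.

End Fs.

Definition additive_map (A B : zmodType) (f : A -> B) := {morph f : x y / x - y}.

Section AdditiveMap.
Variables (A B : zmodType) (f : A -> B).
Hypothesis fB : additive_map f.

Lemma addmap0 : f 0 = 0. Proof. by rewrite -(subrr 0) fB subrr. Qed.
Lemma addmapN x : f (- x) = - f x. Proof. by rewrite -[- x]sub0r fB addmap0 sub0r. Qed.
Lemma addmapD x y : f (x + y) = f x + f y.
Proof. by rewrite -[y in LHS]opprK fB addmapN opprK. Qed.
Lemma addmap_sum (K : Type) (s : seq K) (P : pred K) (F : K -> A) :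
  f (\sum_(k <- s | P k) F k) = \sum_(k <- s | P k) f (F k).
Proof. exact: (big_morph f addmapD addmap0). Qed.
End AdditiveMap.

Section Lift.
Variables (S : pzRingType) (I : choiceType) (M : lmodType S).

Section Universal.
Variables (V : zmodType) (phi : I -> M -> V).
Hypothesis phiB : forall i, additive_map (phi i).

(** The universal property of the direct sum. *)
Definition fs_lift (y : fs I M) : V := \sum_(i <- supp y) phi i (y i).

Lemma fs_lift_supp (y : fs I M) (s : seq I) : uniq s -> (forall i, i \notin s -> y i = 0) ->
  fs_lift y = \sum_(i <- s) phi i (y i).
Proof.
move=> us hs.
have E (t : seq I) : \sum_(i <- t) phi i (y i) = \sum_(i <- [seq i <- t | y i != 0]) phi i (y i).
  rewrite big_filter [RHS]big_mkcond; apply: eq_bigr => i _.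
  by case: eqP => //= ->; rewrite addmap0.
rewrite /fs_lift E [RHS]E; apply: perm_big; apply: uniq_perm; rewrite ?filter_uniq ?undup_uniq //.
move=> i; rewrite !mem_filter; case: eqP => //= /eqP yi.
have /negbNE -> : ~~ (i \notin s) by apply: contraNN yi => /hs ->.
by apply/negbNE; apply: contraNN yi => /suppP ->.
Qed.

Lemma fs_liftB : additive_map fs_lift.
Proof.
suff H (y z : fs I M) : fs_lift (y - z) = fs_lift y - fs_lift z by exact: H.
pose s := undup (supp y ++ supp z).
have hs (i : I) : i \notin s -> y i = 0 /\ z i = 0.
  by rewrite mem_undup mem_cat negb_or => /andP[/suppP -> /suppP ->].
rewrite (@fs_lift_supp (y - z) s) ?(@fs_lift_supp y s) ?(@fs_lift_supp z s) ?undup_uniq //;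
  try by move=> i /hs[yi zi]; rewrite ?fsB ?yi ?zi ?subr0.
by rewrite -sumrB; apply: eq_bigr => i _; rewrite fsB phiB.
Qed.

Lemma fs_lift_single i x : fs_lift (single i x) = phi i x.
Proof.
rewrite (@fs_lift_supp _ [:: i]) // ?big_seq1 ?singleE ?eqxx //.
by move=> j; rewrite inE singleE => /negPf ->.
Qed.

End Universal.

Lemma fs_ind (P : fs I M -> Prop) :
  P 0 -> (forall y z, P y -> P z -> P (y + z)) -> (forall i x, P (single i x)) ->
  forall y, P y.
Proof. by move=> P0 PD P1 y; rewrite (fs_decomp y); apply: big_ind. Qed.

Lemma fs_ext (V : zmodType) (f g : fs I M -> V) : additive_map f -> additive_map g ->
  (forall i x, f (single i x) = g (single i x)) -> f =1 g.
Proof.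
move=> fB gB h; apply: fs_ind => [|y z fy fz|//]; first by rewrite !addmap0.
by rewrite !addmapD // fy fz.
Qed.

End Lift.

Section MapFs.
Variables (S S' : pzRingType) (I : choiceType) (M : lmodType S) (N : lmodType S').
Variable (f : M -> N).

Fact map_fs_finite (f0 : f 0 = 0) (y : fs I M) :
  exists s : seq I, forall i, i \notin s -> f (y i) = 0.
Proof. by have [s hs] := fs_finite y; exists s => i /hs ->. Qed.

Definition map_fs (f0 : f 0 = 0) (y : fs I M) : fs I N := mk_fs (map_fs_finite f0 y).

Lemma map_fsE f0 y i : map_fs f0 y i = f (y i). Proof. by []. Qed.

Lemma map_fsB f0 : additive_map f -> additive_map (map_fs f0).
Proof. by move=> fB y z; apply: fsP => i; rewrite fsB !map_fsE fsB fB. Qed.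

Lemma map_fs_single f0 i x : map_fs f0 (single i x) = single i (f x).
Proof. by apply: fsP => j; rewrite map_fsE !singleE; case: ifP. Qed.
End MapFs.

(** * Matrices acting on families of elements of a right module *)

Section Boundary.
Variable R : pzRingType.
Variables I J : choiceType.
Variable D : I -> fs J R^o.

(** The linear map of free left modules given by the matrix with rows D i; the map
    [bd] below is its tensor product with a right module. *)
Definition bdL (u : fs I R^o) : fs J R^o := fs_lift (fun i (r : R^o) => (r : R) *: D i) u.

Fact bdL_additive (i : I) : additive_map (fun r : R^o => (r : R) *: D i).
Proof. by move=> r r'; rewrite scalerBl. Qed.

Lemma bdL_single i r : bdL (single i r) = (r : R) *: D i.
Proof. by rewrite /bdL fs_lift_single //; exact: bdL_additive. Qed.

Lemma bdLB : additive_map bdL.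
Proof. exact/fs_liftB/bdL_additive. Qed.

Lemma bdL_linear : linear bdL.
Proof.
move=> r u v; rewrite (addmapD bdLB); congr (_ + _).
apply: (@fs_ext _ _ _ _ (fun u : fs I R^o => bdL (r *: u)) (fun u => r *: bdL u)).
- by move=> x y; rewrite scalerBr bdLB.
- by move=> x y; rewrite bdLB scalerBr.
move=> i x.
have -> : r *: single i x = single i (r *: x).
  by apply: fsP => j; rewrite fsZ !singleE; case: ifP; rewrite ?scaler0.
by rewrite !bdL_single scalerA.
Qed.

Section Module.
Variable M : rmodType R.

Fact act_additive x : additive_map (fun r : R^o => (r : R^c) *: (x : M)).
Proof. by move=> r s; rewrite scalerBl. Qed.

(** The tensor product of x and u, where the tensor product of M and the free left
    module on K is identified with the families of elements of M. *)
Definition scale_row (x : M) (K : choiceType) (u : fs K R^o) : fs K M :=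
  map_fs (addmap0 (act_additive x)) u.

Lemma scale_rowE x K (u : fs K R^o) j : scale_row x u j = ((u j : R) : R^c) *: x.
Proof. by []. Qed.

Definition bd (y : fs I M) : fs J M := fs_lift (fun i x => scale_row x (D i)) y.

Lemma scale_rowBl K (u : fs K R^o) : additive_map (fun x => scale_row x u).
Proof. by move=> x y; apply: fsP => j; rewrite fsB !scale_rowE scalerBr. Qed.

Lemma scale_rowB K x : additive_map (scale_row x (K := K)).
Proof. by apply: map_fsB; exact: act_additive. Qed.

Lemma bdB : additive_map bd.
Proof. by apply: fs_liftB => i; apply: scale_rowBl. Qed.

Lemma bd_single i x : bd (single i x) = scale_row x (D i).
Proof. by rewrite /bd fs_lift_single // => j; apply: scale_rowBl. Qed.

Lemma bdE (y : fs I M) (s : seq I) j : uniq s -> (forall i, i \notin s -> y i = 0) ->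
  bd y j = \sum_(i <- s) ((D i j : R) : R^c) *: y i.
Proof.
move=> us hs; rewrite /bd (@fs_lift_supp _ _ _ _ _ _ _ s) // ?fs_sum //.
by move=> i; apply: scale_rowBl.
Qed.

(** The associativity x (u D) = (x u) D. *)
Lemma scale_row_bdL x (u : fs I R^o) : scale_row x (bdL u) = bd (scale_row x u).
Proof.
apply: (@fs_ext _ _ _ _ (fun u => scale_row x (bdL u)) (fun u => bd (scale_row x u))).
- by move=> v w; rewrite bdLB scale_rowB.
- by move=> v w; rewrite scale_rowB bdB.
move=> i r; rewrite bdL_single.
have -> : scale_row x (single i r) = single i ((r : R^c) *: x).
  by apply: fsP => j; rewrite scale_rowE !singleE; case: ifP; rewrite ?scale0r.
by rewrite bd_single; apply: fsP => j; rewrite !scale_rowE scalerA.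
Qed.

End Module.
End Boundary.

Lemma bd_map (R : pzRingType) (I J : choiceType) (D : I -> fs J R^o) (M N : rmodType R)
  (f : {linear M -> N}) (y : fs I M) :
  bd D (map_fs (linear0 f) y) = map_fs (linear0 f) (bd D y).
Proof.
have fB : additive_map f by move=> a b; rewrite linearB.
apply: (@fs_ext _ _ _ _ (fun y => bd D (map_fs (linear0 f) y))
  (fun y => map_fs (linear0 f) (bd D y))).
- by move=> u v; rewrite map_fsB // bdB.
- by move=> u v; rewrite bdB map_fsB.
move=> i x; rewrite map_fs_single !bd_single; apply: fsP => j.
by rewrite map_fsE !scale_rowE linearZ.
Qed.

Lemma bd_bd (R : pzRingType) (I J K : choiceType) (D : I -> fs J R^o) (E : J -> fs K R^o)
  (M : rmodType R) (y : fs I M) : (forall i, bdL E (D i) = 0) -> bd E (bd D y) = 0.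
Proof.
move=> ED; move: y; apply: (@fs_ext _ _ _ _ (fun y => bd E (bd D y)) (fun=> 0)).
- by move=> u v; rewrite !bdB.
- by move=> u v; rewrite subr0.
move=> i x; rewrite bd_single -scale_row_bdL ED; exact: (addmap0 (scale_rowB x)).
Qed.

(** * Vanishing of Tor *)

(** A free resolution, given by its matrices, of the cokernel of [mat 0]. *)
Record resolution (R : pzRingType) := Resolution {
  basis : nat -> choiceType;
  mat : forall k, basis k.+1 -> fs (basis k) R^o;
  mat_mat : forall k i, bdL (@mat k) (@mat k.+1 i) = 0;
  mat_exact : forall k (u : fs (basis k.+1) R^o), bdL (@mat k) u = 0 ->
    exists v, bdL (@mat k.+1) v = u }.

Arguments mat {R} r k _ : rename.
Arguments mat_exact {R} r k u _ : rename.
Arguments mat_mat {R} r k i : rename.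

Definition shift_resolution (R : pzRingType) (G : resolution R) : resolution R :=
  @Resolution R (fun k => basis G k.+1) (fun k => mat G k.+1)
    (fun k => mat_mat G k.+1) (fun k => mat_exact G k.+1).

Section Submods.
Variables (S : pzRingType) (N : lmodType S).

Fact zero_closed : [set 0] (0 : N) /\
  forall (r : S) x y, [set (0 : N)] x -> [set 0] y -> [set 0] (r *: x + y).
Proof. by split=> // r _ _ -> ->; rewrite /= scaler0 addr0. Qed.
Definition zero_submod : submod N := Submod zero_closed.

Fact full_closed : [set: N] 0 /\
  forall (r : S) x y, [set: N] x -> [set: N] y -> [set: N] (r *: x + y).
Proof. by []. Qed.
Definition full_submod : submod N := Submod full_closed.
End Submods.

Arguments zero_submod {S} N.
Arguments full_submod {S} N.

Section Tor.
Variable R : pzRingType.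

Section Defs.
Variables (N : rmodType R) (G : resolution R).

(** Cycles modulo U. In degree 0 everything is a cycle, so that dimension shifting
    can start from the zero module in degree 0. *)
Definition relative_cycle (U : submod N) k : fs (basis G k) N -> Prop :=
  match k with
  | 0 => fun=> True
  | k.+1 => fun y => forall j, U (bd (mat G k) y j)
  end.

Definition acyclic_at k (X U : submod N) : Prop :=
  forall y : fs (basis G k) N, (forall i, X (y i)) -> relative_cycle U y ->
  exists2 w : fs (basis G k.+1) N, forall i, X (w i) &
    forall j, U (bd (mat G k) w j - y j).
End Defs.

(** For submodules U <= X of N, this is the vanishing of Tor_k (X / U, C) for all left
    modules C. *)
Definition tor_zero k (N : rmodType R) (X U : submod N) : Prop :=
  forall G : resolution R, acyclic_at G k X U.

Section Chain.
Variable N : rmodType R.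
Implicit Types X Y U : submod N.

(** Tor_(k+1) of C is Tor_k of a syzygy of C, and the tail of a resolution is a
    resolution. *)
Lemma tor_zeroS k X U : tor_zero k X U -> tor_zero k.+1 X U.
Proof.
move=> h G y Xy cy; apply: (h (shift_resolution G) y Xy).
by case: k y {h} Xy cy.
Qed.

Lemma bd_mat_mat (G : resolution R) k (y : fs (basis G k.+2) N) :
  bd (mat G k) (bd (mat G k.+1) y) = 0.
Proof. by apply: bd_bd; apply: mat_mat. Qed.

(** Exactness of Tor_(k+1) X -> Tor_(k+1) (X / U) -> Tor_k U. *)
Lemma tor_zero_quotient k X U : (forall x, U x -> X x) ->
  tor_zero k.+1 X (zero_submod N) -> tor_zero k U (zero_submod N) -> tor_zero k.+1 X U.
Proof.
move=> UX tX tU G y Xy cy.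
have [m Um hm] : exists2 m : fs (basis G k.+1) N, forall i, U (m i) &
    forall j, zero_submod N (bd (mat G k) m j - bd (mat G k) y j).
  apply: tU => //; case: k {tX} y Xy cy => [//|k] y Xy cy j /=.
  by rewrite bd_mat_mat.
have [||w Xw hw] := tX G (y - m).
- by move=> i; rewrite fsB; apply: submodB => //; apply: UX.
- by move=> j /=; rewrite bdB fsB -opprB hm oppr0.
exists w => // j; move/eqP: (hw j); rewrite fsB opprB addrCA addr_eq0 => /eqP.
by rewrite -opprB => h; rewrite -[_ - _]opprK -h; apply: submod_opp.
Qed.

(** Exactness of Tor_(k+1) (X / Y) -> Tor_k Y -> Tor_k X. *)
Lemma tor_zero_sub k X Y : (forall x, Y x -> X x) ->
  tor_zero k.+1 X Y -> tor_zero k X (zero_submod N) -> tor_zero k Y (zero_submod N).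
Proof.
move=> YX tXY tX G y Yy cy.
have [||w Xw /= hw] := tX G y; [by move=> i; apply: YX|exact: cy|].
have {}hw : bd (mat G k) w = y by apply: fsP => j; apply/eqP; rewrite -subr_eq0 hw.
have [|v Xv hv] := tXY G w Xw; first by move=> j /=; rewrite hw.
exists (w - bd (mat G k.+1) v).
  by move=> i; rewrite fsB -opprB; apply: submod_opp.
by move=> j /=; rewrite bdB bd_mat_mat subr0 hw subrr.
Qed.

(** For U <= Y, this is the purity of Y / U in N / U. *)
Definition relatively_pure U Y : Prop :=
  forall (m k : nat) (a : 'I_m -> 'I_k -> R^c) (c : 'I_m -> N),
    (forall i, Y (c i)) ->
    (exists x : 'I_k -> N, forall i, U (\sum_(j < k) a i j *: x j - c i)) ->
    exists2 x : 'I_k -> N,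
      (forall j, Y (x j)) & forall i, U (\sum_(j < k) a i j *: x j - c i).

(** Although the matrix D is infinite, the support of y selects finitely many of its
    rows, and these have finitely many nonzero entries: the unknown z solves a
    finite system. *)
Lemma relatively_pure_bd U Y : relatively_pure U Y ->
  forall (I J : choiceType) (D : I -> fs J R^o) (y : fs I N), (forall j, Y (bd D y j)) ->
  exists2 z : fs I N, (forall i, Y (z i)) & forall j, U (bd D z j - bd D y j).
Proof.
move=> pY I J D y hy.
pose s := supp y; pose t := flatten [seq supp (D i) | i <- s].
have ht (z : fs I N) j : (forall i : I, i \notin s -> z i = 0) -> j \notin t -> bd D z j = 0.
  move=> hz jt; rewrite (@bdE _ _ _ _ _ _ s) ?undup_uniq //.
  rewrite big_seq big1 // => i si; rewrite suppP ?scale0r //.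
  by apply: contra jt => jD; apply/flatten_mapP; exists i.
pose T := in_tuple t; pose S := in_tuple s.
have hE (z : fs I N) j : (forall i : I, i \notin s -> z i = 0) ->
    bd D z j = \sum_(i < size s) ((D (tnth S i) j : R) : R^c) *: z (tnth S i).
  by move=> hz; rewrite (@bdE _ _ _ _ _ _ s) ?undup_uniq // big_tnth.
have [||x Yx hx] := pY _ _ (fun l i => (D (tnth S i) (tnth T l) : R)) (fun l => bd D y (tnth T l)).
- by [].
- exists (fun i => y (tnth S i)) => l; rewrite -hE ?subrr; last exact: suppP.
  by case: (submodP U).
pose z : fs I N := \sum_(i < size s) single (tnth S i) (x i).
have zE i : z (tnth S i) = x i.
  rewrite fs_sum (bigD1 i) //= singleE eqxx big1 ?addr0 // => i' ii'.
  rewrite singleE; case: eqP => // /tuple_uniqP h; case/eqP: ii'.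
  by apply/esym/h; apply: undup_uniq.
have zs i : i \notin s -> z i = 0.
  move=> ni; rewrite fs_sum big1 // => j _; rewrite singleE; case: eqP => // e.
  by rewrite e mem_tnth in ni.
exists z => [i|j].
  have [si|/zs ->] := boolP (i \in s); last by case: (submodP Y).
  by have /tnthP[j ->] : i \in S by []; rewrite zE.
have [jt|jt] := boolP (j \in t); last first.
  rewrite !ht ?subrr //; [by case: (submodP U)|exact: suppP].
have /tnthP[l ->] : j \in T by [].
rewrite hE //; move: (hx l); congr (U (_ - _)); apply: eq_bigr => i _.
by rewrite zE.
Qed.

(** Pure quotients do not raise the flat dimension: a cycle modulo Y differs from a
    cycle modulo U by a family of elements of Y. *)
Lemma tor_zero_relatively_pure k U Y : (forall x, U x -> Y x) -> relatively_pure U Y ->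
  tor_zero k.+1 (full_submod N) U -> tor_zero k.+1 (full_submod N) Y.
Proof.
move=> UY pY tU G y _ cy.
have [z Yz hz] := relatively_pure_bd pY cy.
have [||w _ hw] := tU G (y - z); first by [].
  move=> j /=; rewrite bdB fsB -opprB; exact: submod_opp.
exists w => // j; have := hw j; rewrite fsB => /UY h.
by rewrite -[y j](subrK (z j)) opprD addrA; apply: submodB.
Qed.

(** Tor vanishes in degree k + 2 on N / U, by the long exact sequence of U, N and
    N / U; hence on its pure quotient N / Y; hence in degree k + 1 on Y, by the long
    exact sequence of Y, N and N / Y. *)
Lemma tor_zero_of_relatively_pure k U Y : (forall x, U x -> Y x) -> relatively_pure U Y ->
  tor_zero k.+1 (full_submod N) (zero_submod N) -> tor_zero k.+1 U (zero_submod N) ->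
  tor_zero k.+1 Y (zero_submod N).
Proof.
move=> UY pY tN tU; apply: (@tor_zero_sub _ (full_submod N)) => //.
apply: (tor_zero_relatively_pure UY pY).
by apply: tor_zero_quotient => //; apply: tor_zeroS.
Qed.

End Chain.

(** Zero is lifted to zero, which keeps the support finite. *)
Lemma lift_chain (I : choiceType) (M N : rmodType R) (f : {linear M -> N}) (y : fs I N) :
  (forall i, range f (y i)) -> exists x : fs I M, map_fs (linear0 f) x = y.
Proof.
move=> /= hy.
have /choice[g gP] : forall i, exists x, f x = y i /\ (y i = 0 -> x = 0).
  move=> i; have [y0|ny0] := pselect (y i = 0); first by exists 0; rewrite linear0.
  by have [x _ hx] := hy i; exists x.
have gf : exists s : seq I, forall i, i \notin s -> g i = 0.
  by exists (supp y) => i /suppP; apply: (gP i).2.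
by exists (mk_fs gf); apply: fsP => i; rewrite map_fsE mk_fsE (gP i).1.
Qed.

(** The two sides present the same module, as M / ker f and as the image of f. *)
Lemma tor_zero_image k (M N : rmodType R) (f : {linear M -> N}) :
  tor_zero k (full_submod M) (ker_submod f) <-> tor_zero k (image_submod f) (zero_submod N).
Proof.
split=> t G y Xy cy.
  have [x xy] := lift_chain Xy.
  have [||w _ hw] := t G x; first by [].
    case: k {t} y Xy cy x xy => //= k y _ cy x xy j /=.
    by rewrite -[RHS](cy j) -xy bd_map.
  exists (map_fs (linear0 f) w); first by move=> i; exists (w i).
  move=> j; have /= := hw j; rewrite linearB => /eqP; rewrite subr_eq0 => /eqP hj.
  by rewrite /= bd_map map_fsE hj -xy map_fsE subrr.
have [||w Xw hw] := t G (map_fs (linear0 f) y).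
- by move=> i; exists (y i).
- by case: k {t} y Xy cy => //= k y _ cy j; rewrite bd_map; exact: cy.
have [v vw] := lift_chain Xw; exists v => // j.
rewrite /= linearB; apply/eqP; rewrite subr_eq0; apply/eqP.
have := hw j; rewrite -vw bd_map map_fsE /= => /eqP.
by rewrite map_fsE subr_eq0 => /eqP.
Qed.

End Tor.

Local Open Scope quotient_scope.

(** * Tensor products *)

Lemma freeg_int_ind (K : choiceType) (P : {freeg K} -> Prop) :
  P 0 -> (forall u v, P u -> P v -> P (u - v)) -> (forall k, P << k >>) -> forall u, P u.
Proof.
move=> P0 PB P1 u.
have PN v : P v -> P (- v) by move=> Pv; rewrite -[- v]sub0r; apply: PB.
have PD v w : P v -> P w -> P (v + w).
  by move=> Pv Pw; rewrite -[w]opprK; apply: PB => //; apply: PN.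
rewrite -[u]freeg_sumE; apply: big_ind => // k _.
rewrite (_ : << _ *g k >> = << k >> *~ coeff k u); last by rewrite freegU_mulz intz.
elim/int_ind: (coeff k u) => [|n IH|n IH]; first by rewrite mulr0z.
  by rewrite -addn1 PoszD mulrzDr mulr1z; apply: PD.
by rewrite -addn1 PoszD opprD mulrzDr !mulrNz mulr1z -mulrNz; apply: PB.
Qed.

Section FglInt.
Variables (K : choiceType) (V : zmodType) (f : K -> V).

(** Abelian groups are modules over the integers, hence receive maps from free
    abelian groups. *)
Definition zlift : {freeg K} -> V := fglift (f : K -> zmodule V).

Lemma zliftB : additive_map zlift.
Proof. by move=> u v; apply: (lift_is_additive (f : K -> zmodule V)). Qed.

Lemma zlift1 k : zlift << k >> = f k.
Proof. by rewrite /zlift liftU scale1r. Qed.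
End FglInt.

Section TensorProduct.
Variables (R : pzRingType) (M : rmodType R).

Section Universal.
Variable A : lmodType R.

Lemma tensBl a : additive_map (fun x : M => tens x (a : A)).
Proof. by move=> x y; apply: (addIr (tens y a)); rewrite -tensDl !subrK. Qed.

Lemma tensBr x : additive_map (fun a : A => tens (x : M) a).
Proof. by move=> a b; apply: (addIr (tens x b)); rewrite -tensDr !subrK. Qed.

Lemma pi_tensorB : additive_map (\pi_(tensor M A) : {freeg (M * A)} -> tensor M A).
Proof. by move=> u v; rewrite raddfB. Qed.

Lemma tensor_ind (P : tensor M A -> Prop) :
  P 0 -> (forall s t, P s -> P t -> P (s - t)) -> (forall x a, P (tens x a)) -> forall t, P t.
Proof.
move=> P0 PB P1 t; rewrite -[t]reprK; move: (repr t).
apply: freeg_int_ind => [|u v Pu Pv|[x a]].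
- by rewrite (addmap0 pi_tensorB).
- by rewrite pi_tensorB; apply: PB.
- exact: P1.
Qed.

Lemma tensor_ext (V : zmodType) (f g : tensor M A -> V) :
  additive_map f -> additive_map g -> (forall x a, f (tens x a) = g (tens x a)) -> f =1 g.
Proof.
move=> fB gB h; apply: tensor_ind => [|s t fs gs|//]; first by rewrite !addmap0.
by rewrite fB gB fs gs.
Qed.

Variables (V : zmodType) (phi : M -> A -> V).
Hypothesis phiBl : forall a, additive_map (phi^~ a).
Hypothesis phiBr : forall x, additive_map (phi x).
Hypothesis phiZ : forall x (r : R) a, phi ((r : R^c) *: x) a = phi x (r *: a).

Definition tlift (t : tensor M A) : V := zlift (fun p => phi p.1 p.2) (repr t).

Lemma tlift_pi u : tlift (\pi_(tensor M A) u) = zlift (fun p => phi p.1 p.2) u.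
Proof.
have H v : tensor_rel v -> zlift (fun p : M * A => phi p.1 p.2) v = 0.
  elim=> [|{}v w _ hv _ hw|x y a|x a b|x r a]; rewrite ?(addmap0 (zliftB _)) //.
  - by rewrite zliftB hv hw subr0.
  - by rewrite !zliftB !zlift1 /= (addmapD (phiBl a)) addrAC addrK subrr.
  - by rewrite !zliftB !zlift1 /= (addmapD (phiBr x)) addrAC addrK subrr.
  - by rewrite !zliftB !zlift1 /= phiZ subrr.
apply/eqP; rewrite -subr_eq0 -zliftB; apply/eqP/H/tens_eq; exact: reprK.
Qed.

Lemma tliftB : additive_map tlift.
Proof. by move=> s t; rewrite -[s]reprK -[t]reprK -raddfB !tlift_pi zliftB. Qed.

Lemma tlift_tens x a : tlift (tens x a) = phi x a.
Proof. by rewrite /tens tlift_pi zlift1. Qed.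

End Universal.

(** Right exactness of the tensor product, as an induction principle for the
    elements of the kernel: they are combinations of tensors x * b with p b = 0. *)
Lemma tensor_map_ker_ind (B C : lmodType R) (p : {linear B -> C}) (Q : tensor M B -> Prop) :
  (forall c, exists b, p b = c) ->
  Q 0 -> (forall s t, Q s -> Q t -> Q (s - t)) ->
  (forall x b, p b = 0 -> Q (tens x b)) ->
  forall t, tensor_map p t = 0 -> Q t.
Proof.
move=> /choice[s sK] Q0 QB Q1 t.
have QN v : Q v -> Q (- v) by move=> Qv; rewrite -[- v]sub0r; apply: QB.
have QD v w : Q v -> Q w -> Q (v + w).
  by move=> Qv Qw; rewrite -[w]opprK; apply: QB => //; apply: QN.
(* L sends the relations defining the tensor product with C to tensors x * b with
   p b = 0, since the section s is linear modulo the kernel of p *)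
pose L := zlift (fun q : M * C => tens q.1 (s q.2)).
have LB : additive_map L by apply: zliftB.
have relL u : tensor_rel u -> Q (L u).
  elim=> [|v w _ hv _ hw|x y a|x a b|x r a].
  - by rewrite (addmap0 LB).
  - by rewrite LB; apply: QB.
  - by rewrite !LB /L !zlift1 /= tensDl addrAC addrK subrr.
  - rewrite !LB /L !zlift1 /= -!tensBr; apply: Q1.
    by rewrite !linearB /= !sK addrAC addrK subrr.
  - rewrite !LB /L !zlift1 /= tensZ -tensBr; apply: Q1.
    by rewrite linearB linearZ /= !sK subrr.
have Lpi u : Q (L (freeg_map p u) - \pi_(tensor M B) u).
  apply: (@freeg_int_ind _ (fun u => Q (L (freeg_map p u) - \pi_(tensor M B) u))) =>
    [|v w hv hw|[x b]].
  - by rewrite -(subrr 0) freeg_mapB !subrr (addmap0 LB) (addmap0 (@pi_tensorB _)) subr0.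
  - rewrite freeg_mapB LB pi_tensorB.
    have -> : forall a b c d : tensor M B, a - b - (c - d) = (a - c) - (b - d).
      by move=> a b c d; rewrite !opprD !opprK addrACA.
    exact: QB.
  - rewrite freeg_map1 /L zlift1 /= -[\pi _]/(tens x b) -tensBr; apply: Q1.
    by rewrite linearB /= sK subrr.
rewrite -[t]reprK tensor_map_pi -[0](addmap0 (@pi_tensorB _)) => /tens_eq.
rewrite subr0 => /relL h.
by have := QB _ _ h (Lpi (repr t)); rewrite opprB addrC subrK.
Qed.

(** The tensor product of M with a free module consists of finitely supported
    families of elements of M. *)
Section TensorFree.
Variable I : choiceType.

Definition tens_basis (y : fs I M) : tensor M (fs I R^o) :=
  fs_lift (fun i x => tens x (single i (1 : R^o))) y.

Lemma tens_basisB : additive_map tens_basis.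
Proof. by apply: fs_liftB => i; apply: tensBl. Qed.

Lemma tens_basis_single i x : tens_basis (single i x) = tens x (single i (1 : R^o)).
Proof. by rewrite /tens_basis fs_lift_single // => j; apply: tensBl. Qed.

Definition coords : tensor M (fs I R^o) -> fs I M :=
  tlift (fun (x : M) (u : fs I R^o) => scale_row x u).

Lemma scale_row_balanced (x : M) (r : R) (u : fs I R^o) :
  scale_row ((r : R^c) *: x) u = scale_row x (r *: u).
Proof. by apply: fsP => i; rewrite !scale_rowE fsZ scalerA. Qed.

Lemma coordsB : additive_map coords.
Proof.
apply: tliftB => [u|x|]; [exact: scale_rowBl|exact: scale_rowB|exact: scale_row_balanced].
Qed.

Lemma coords_tens x u : coords (tens x u) = scale_row (x : M) u.
Proof.
apply: tlift_tens => [v|y|]; [exact: scale_rowBl|exact: scale_rowB|exact: scale_row_balanced].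
Qed.

Lemma tens_basisK : cancel tens_basis coords.
Proof.
apply: fs_ext => [y z|//|i x]; first by rewrite tens_basisB coordsB.
rewrite tens_basis_single coords_tens; apply: fsP => j.
by rewrite scale_rowE !singleE; case: ifP; rewrite ?scale1r ?scale0r.
Qed.

Lemma tens_basis_row (x : M) (u : fs I R^o) : tens_basis (scale_row x u) = tens x u.
Proof.
apply: (@fs_ext _ _ _ _ (fun u => tens_basis (scale_row x u)) (tens x)).
- by move=> v w; rewrite scale_rowB tens_basisB.
- exact: tensBr.
move=> i r.
have -> : scale_row x (single i r) = single i ((r : R^c) *: x).
  by apply: fsP => j; rewrite scale_rowE !singleE; case: ifP; rewrite ?scale0r.
rewrite tens_basis_single tensZ; congr tens; apply: fsP => j.
by rewrite fsZ !singleE; case: ifP; rewrite ?scaler0 // /GRing.scale /= mulr1.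
Qed.

Lemma coordsK : cancel coords tens_basis.
Proof.
apply: tensor_ext => [s t|//|x u]; first by rewrite coordsB tens_basisB.
by rewrite coords_tens tens_basis_row.
Qed.

End TensorFree.

Lemma tensor_map_basis (I J : choiceType) (D : I -> fs J R^o) (y : fs I M) :
  tensor_map (lin_of (bdL_linear D)) (tens_basis y) = tens_basis (bd D y).
Proof.
move: y; apply: (@fs_ext _ _ _ _
  (fun y => tensor_map (lin_of (bdL_linear D)) (tens_basis y)) (fun y => tens_basis (bd D y))).
- by move=> y z; rewrite tens_basisB tensor_mapB.
- by move=> y z; rewrite bdB tens_basisB.
move=> i x; rewrite tens_basis_single tensor_map_tens bd_single tens_basis_row.
by congr tens; rewrite lin_ofE bdL_single scale1r.
Qed.

End TensorProduct.

Section Corestriction.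
Variables (S : pzRingType) (A N : lmodType S) (f : {linear A -> N}) (Y : submod N).
Hypothesis fY : forall x, Y (f x).

Definition corestr_fun (x : A) : submod_type Y := in_submod (fY x).

Fact corestr_linear : linear corestr_fun.
Proof. by move=> r x y; apply: submod_incl_inj; rewrite [RHS]linearP; exact: linearP. Qed.

Definition corestr : {linear A -> submod_type Y} := lin_of corestr_linear.

Lemma corestrE x : submod_inclL Y (corestr x) = f x.
Proof. by []. Qed.
End Corestriction.

Section FreeCover.
Variables (S : pzRingType) (B : lmodType S).

Definition free_cover_fun (u : fs B S^o) : B := fs_lift (fun b (r : S^o) => (r : S) *: b) u.

Fact free_cover_additive (b : B) : additive_map (fun r : S^o => (r : S) *: b).
Proof. by move=> r s; rewrite scalerBl. Qed.

Fact free_cover_linear : linear free_cover_fun.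
Proof.
have cB : additive_map free_cover_fun by apply/fs_liftB/free_cover_additive.
move=> r u v; rewrite (addmapD cB); congr (_ + _).
apply: (@fs_ext _ _ _ _ (fun u => free_cover_fun (r *: u)) (fun u => r *: free_cover_fun u)).
- by move=> x y; rewrite scalerBr cB.
- by move=> x y; rewrite cB scalerBr.
move=> b x; have -> : r *: single b x = single b (r *: x).
  by apply: fsP => j; rewrite fsZ !singleE; case: ifP; rewrite ?scaler0.
by rewrite /free_cover_fun !fs_lift_single ?scalerA //; apply: free_cover_additive.
Qed.

Definition free_cover : {linear fs B S^o -> B} := lin_of free_cover_linear.

Lemma free_cover_single b : free_cover (single b (1 : S^o)) = b.
Proof.
by rewrite lin_ofE /free_cover_fun fs_lift_single ?scale1r //; apply: free_cover_additive.
Qed.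
End FreeCover.

(** * Flat modules and Tor *)

Section Flat.
Variable R : pzRingType.

Lemma tensor_map_comp (M : rmodType R) (A B C : lmodType R) (f : {linear A -> B})
    (g : {linear B -> C}) (h : {linear A -> C}) : (forall x, g (f x) = h x) ->
  forall t : tensor M A, tensor_map g (tensor_map f t) = tensor_map h t.
Proof.
move=> gf; apply: tensor_ext => [s t|s t|x a]; rewrite ?tensor_mapB //.
by rewrite !tensor_map_tens gf.
Qed.

Lemma tensor_map0 (M : rmodType R) (A B : lmodType R) (f : {linear A -> B}) :
  tensor_map f 0 = 0 :> tensor M B.
Proof. exact: addmap0 (@tensor_mapB _ _ _ _ _). Qed.

(** Let C be the image of [mat k]. Flatness makes F * C embed in the families
    in degree k, so a cycle vanishes in F * C; by right exactness it comes from the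
    kernel of the map onto C, which is the image of the next matrix. *)
Lemma flat_tor_zero (F : rmodType R) k :
  flat F -> tor_zero k.+1 (full_submod F) (zero_submod F).
Proof.
move=> flatF G y _ /= cy.
have {}cy : bd (mat G k) y = 0 by apply: fsP.
pose p0 := lin_of (bdL_linear (mat G k)).
pose p1 := lin_of (bdL_linear (mat G k.+1)).
pose p := corestr (Y := image_submod p0) (fun x => ex_intro2 _ _ x I erefl).
have pE u : submod_inclL _ (p u) = p0 u by [].
have p_onto c : exists u, p u = c.
  by have [u _ uc] := submod_inclP c; exists u; apply: submod_incl_inj; rewrite pE.
have p_ker : tensor_map p (tens_basis y) = 0.
  apply: (flatF _ _ _ (@submod_incl_inj _ _ (image_submod p0))).
  by rewrite (tensor_map_comp pE) tensor_map_basis cy tensor_map0 (addmap0 (@tens_basisB _ _ _)).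
have [t ht] : exists t, tens_basis y = tensor_map p1 t.
  apply: (@tensor_map_ker_ind _ _ _ _ p (fun s => exists t, s = tensor_map p1 t)) p_ker => //.
  - by exists 0; rewrite tensor_map0.
  - by move=> _ _ [s ->] [t ->]; exists (s - t); rewrite tensor_mapB.
  move=> x u /(congr1 (submod_inclL _)); rewrite pE linear0 => /mat_exact[v vu].
  by exists (tens x v); rewrite tensor_map_tens lin_ofE vu.
exists (coords t) => // j /=; apply/eqP; rewrite subr_eq0; apply/eqP; congr (fs_fun _ j).
apply: (can_inj (@tens_basisK _ _ _)).
by rewrite ht -tensor_map_basis coordsK.
Qed.

Record stage := Stage { scod : choiceType; sdom : choiceType; smat : sdom -> fs scod R^o }.

(** The free module on all the elements of the kernel maps onto the kernel. *)
Definition next_stage (s : stage) : stage :=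
  let K := ker_submod (lin_of (bdL_linear (@smat s))) in
  @Stage (sdom s) (submod_type K) (fun v : submod_type K => submod_inclL K v).

Definition free_resolution (I J : choiceType) (D : I -> fs J R^o) : resolution R.
Proof.
pose s k := iter k next_stage (Stage D).
exists (fun k => scod (s k)) (fun k => @smat (s k)) => [k v|k u hu].
  exact: (submod_inclP v).
pose K := ker_submod (lin_of (bdL_linear (@smat (s k)))).
exists (single (in_submod (Y := K) hu : sdom (s k.+1)) (1 : R^o)).
by rewrite bdL_single scale1r.
Defined.

(** Let f : A -> B be injective, G_0 the free module on B, with its map p onto B, and P
    the preimage of A in G_0, with its map q onto A. If an element t of K * A vanishes
    in K * B, lift it along q to a combination y of elements of P. By right exactness
    of the tensor product with p, the image of y in K * G_0 is also the image of a
    combination z of elements of the kernel of p, so z vanishes in K * A. As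
    Tor_1 (K, G_0 / P) = 0, the difference y - z comes from the relations between
    the elements of P, so y and z have the same image t = 0 in K * A. *)
Lemma flat_of_tor_zero (K : rmodType R) :
  tor_zero 1 (full_submod K) (zero_submod K) -> flat K.
Proof.
move=> tK A B f f_inj.
suff ker0 t : tensor_map f t = 0 -> t = 0 :> tensor K A.
  by move=> s t /eqP; rewrite -subr_eq0 -tensor_mapB => /eqP/ker0/eqP; rewrite subr_eq0 => /eqP.
pose p := free_cover B.
pose P := {u : fs B R^o | `[< exists a, f a = p u >]}.
pose mkP u (h : exists a, f a = p u) : P := Sub u (asboolT h).
pose D0 (u : P) : fs B R^o := val u.
have /choice[q qE] : forall u : P, exists a, f a = p (D0 u) by move=> u; apply/asboolP/(valP u).
pose G := free_resolution D0.
pose theta (y : fs P K) : tensor K A := fs_lift (fun u x => tens x (q u)) y.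
have thetaB : additive_map theta by apply: fs_liftB => u; apply: tensBl.
have theta1 u x : theta (single u x) = tens x (q u).
  by rewrite /theta fs_lift_single // => v; apply: tensBl.
have f_theta y : tensor_map f (theta y) = tensor_map p (tens_basis (bd D0 y)).
  move: y; apply: fs_ext => [y z|y z|u x].
  - by rewrite thetaB tensor_mapB.
  - by rewrite bdB tens_basisB tensor_mapB.
  by rewrite theta1 bd_single tens_basis_row !tensor_map_tens qE.
have [y <-] : exists y, theta y = t.
  apply: (@tensor_ind _ _ _ (fun t => exists y, theta y = t)) => [|_ _ [y <-] [z <-]|x a].
  - by exists 0; rewrite (addmap0 thetaB).
  - by exists (y - z); rewrite thetaB.
  have h : exists a', f a' = p (single (f a) (1 : R^o)) by exists a; rewrite free_cover_single.
  exists (single (mkP _ h) x); rewrite theta1; congr tens.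
  by apply: f_inj; rewrite qE free_cover_single.
rewrite f_theta => h.
have [z [hz tz]] : exists z, tens_basis (bd D0 z) = tens_basis (bd D0 y) /\ theta z = 0.
  apply: (@tensor_map_ker_ind _ _ _ _ p
    (fun s => exists z, tens_basis (bd D0 z) = s /\ theta z = 0)) h.
  - by move=> b; exists (single b (1 : R^o)); rewrite free_cover_single.
  - exists 0; rewrite (addmap0 (bdB D0 (M := K))) (addmap0 thetaB).
    by rewrite (addmap0 (@tens_basisB _ _ _)).
  - move=> _ _ [z [<- hz]] [w [<- hw]]; exists (z - w).
    by rewrite bdB tens_basisB thetaB hz hw subrr.
  move=> x u pu; have hu : exists a, f a = p u by exists 0; rewrite pu linear0.
  exists (single (mkP _ hu) x); split; first by rewrite bd_single tens_basis_row.
  rewrite theta1 (_ : q _ = 0) ?(addmap0 (@tensBr _ _ _ x)) //.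
  by apply: f_inj; rewrite qE pu linear0.
have yz0 : bd D0 (y - z) = 0.
  by rewrite bdB -[bd D0 y](@tens_basisK _ _ _) -hz tens_basisK subrr.
have [//|j /=|w _ hw] := tK G (y - z).
  by rewrite -[bd _ _]/(bd D0 (y - z)) yz0.
(* a relation between elements of P holds between their images in A *)
have theta_bd v : theta (bd (mat G 1%N) v) = 0.
  move: v; apply: (@fs_ext _ _ _ _ (fun v => theta (bd (mat G 1%N) v)) (fun=> 0)).
  - by move=> a b; rewrite bdB thetaB.
  - by move=> a b; rewrite subr0.
  move=> u x; rewrite bd_single.
  have : bdL D0 (mat G 1%N u) = 0 by exact: (submod_inclP u).
  move: (mat G 1%N u) => {}u hu.
  have -> : theta (scale_row x u) = tens x (\sum_(v <- supp u) (u v : R) *: q v).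
    rewrite (addmap_sum (@tensBr _ _ _ x)) /theta (@fs_lift_supp _ _ _ _ _ _ _ (supp u)).
    + by apply: eq_bigr => v _; rewrite scale_rowE tensZ.
    + by move=> v; apply: tensBl.
    + exact: undup_uniq.
    + by move=> v /suppP uv; rewrite scale_rowE uv scale0r.
  rewrite (_ : \sum_(v <- _) _ = 0) ?(addmap0 (@tensBr _ _ _ x)) //.
  apply: f_inj; rewrite linear0 linear_sum -[RHS](linear0 p) -hu /bdL.
  rewrite (@fs_lift_supp _ _ _ _ _ _ _ (supp u)) ?undup_uniq //; last exact: suppP.
    rewrite linear_sum; apply: eq_bigr => v _.
    by rewrite linearZ /= qE -[RHS]/(p _) linearZ.
  by move=> i; apply: bdL_additive.
have : bd (mat G 1%N) w = y - z by apply: fsP => j; apply/eqP; rewrite -subr_eq0; apply/eqP/hw.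
by move/(congr1 theta); rewrite theta_bd thetaB tz subr0.
Qed.

End Flat.

(** * Flat dimension and Tor *)

Section FlatDimensionTor.
Variable R : pzRingType.

(** The complex of a free module is a direct sum of copies of the resolution: u and v
    below are components, and E puts a component back into its place. *)
Lemma tor_zero_free (J : choiceType) k :
  tor_zero k.+1 (full_submod (fs J (R^c)^o)) (zero_submod (fs J (R^c)^o)).
Proof.
move=> G y _ /= cy.
have cB (j : J) : additive_map (fun z : fs J (R^c)^o => z j : R^o) by [].
pose u j : fs (basis G k.+1) R^o := map_fs (addmap0 (cB j)) y.
have uD j : bdL (mat G k) (u j) = 0.
  apply: fsP => l; have : (bd (mat G k) y l : fs J _) j = 0 by rewrite (cy l).
  rewrite (@bdE _ _ _ _ _ _ (supp y)) ?undup_uniq //; last exact: suppP.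
  rewrite fs_sum /bdL => h; rewrite (@fs_lift_supp _ _ _ _ _ _ _ (supp y)) ?undup_uniq //.
  - by rewrite fs_sum fs0 -[RHS]h; apply: eq_bigr => i _; rewrite !fsZ.
  - by move=> i; apply: bdL_additive.
  - by move=> i /suppP yi; rewrite map_fsE yi.
have /choice[v hv] : forall j, exists v, bdL (mat G k.+1) v = u j.
  by move=> j; apply: mat_exact.
have sB (j : J) : additive_map (fun r : R^o => single j (r : (R^c)^o)).
  by move=> r s; exact: singleB.
pose E (I : choiceType) (j : J) (z : fs I R^o) : fs I (fs J (R^c)^o) := map_fs (addmap0 (sB j)) z.
have EB I j : additive_map (@E I j) by apply: map_fsB.
have bdE j (z : fs (basis G k.+2) R^o) : bd (mat G k.+1) (E _ j z) = E _ j (bdL (mat G k.+1) z).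
  move: z; apply: (@fs_ext _ _ _ _ (fun z => bd _ (E _ j z)) (fun z => E _ j (bdL _ z))).
  - by move=> a b; rewrite EB bdB.
  - by move=> a b; rewrite bdLB EB.
  move=> i r; rewrite bdL_single /E map_fs_single bd_single; apply: fsP => l.
  rewrite scale_rowE map_fsE; apply: fsP => j'; rewrite fsZ !singleE fsZ.
  by case: ifP; rewrite ?scaler0.
pose t := undup (flatten [seq supp (y i) | i <- supp y]).
have yE : y = \sum_(j <- t) E _ j (u j).
  apply: fsP => i; apply: fsP => j; rewrite !fs_sum.
  have [jt|jt] := boolP (j \in t).
    rewrite (bigD1_seq j) ?undup_uniq //= !map_fsE singleE eqxx big1 ?addr0 // => j'.
    by rewrite map_fsE singleE eq_sym => /negPf ->.
  rewrite big_seq big1 => [|j' j't]; last first.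
    by rewrite map_fsE singleE; case: eqP => // jj'; rewrite jj' j't in jt.
  have [si|/suppP -> //] := boolP (i \in supp y).
  apply: suppP; apply: contra jt => sj; rewrite mem_undup.
  by apply/flatten_mapP; exists i.
exists (\sum_(j <- t) E _ j (v j)) => // l /=.
rewrite (addmap_sum (@bdB _ _ _ _ _)) {1}yE -fsB -sumrB big1 // => j _.
by rewrite bdE hv subrr.
Qed.

Lemma tor_zero_eq k (N : rmodType R) (X X' U U' : submod N) :
  (forall x, X x <-> X' x) -> (forall x, U x <-> U' x) -> tor_zero k X U -> tor_zero k X' U'.
Proof.
move=> eX eU t G y Xy cy.
have [||w Xw hw] := t G y.
- by move=> i; apply/eX.
- by case: k {t} y Xy cy => //= k y _ cy j; apply/eU.
by exists w => [i|j]; [apply/eX|apply/eU].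
Qed.

Lemma tor_zero_trivial k (N : rmodType R) (X : submod N) :
  (forall x, X x -> x = 0) -> tor_zero k X (zero_submod N).
Proof.
move=> X0 G y Xy _; exists 0 => [i|j]; first by case: (submodP X).
by rewrite /= (addmap0 (@bdB _ _ _ _ _)) (X0 _ (Xy j)) subrr.
Qed.

Lemma tor_zero_injective k (M N : rmodType R) (f : {linear M -> N}) : injective f ->
  tor_zero k (full_submod M) (zero_submod M) <-> tor_zero k (image_submod f) (zero_submod N).
Proof.
move=> fI; rewrite -tor_zero_image.
have e x : zero_submod M x <-> ker_submod f x.
  by split=> [->|fx]; [exact: linear0|apply: fI; rewrite linear0].
by split; apply: tor_zero_eq => // x; split=> /e.
Qed.

Lemma tor_zero_submod_type k (N : rmodType R) (Y : submod N) :
  tor_zero k (full_submod (submod_type Y)) (zero_submod (submod_type Y)) <->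
  tor_zero k Y (zero_submod N).
Proof.
rewrite (tor_zero_injective _ (@submod_incl_inj _ _ Y)).
have e x : range (submod_inclL Y) x <-> Y x by rewrite range_submod_incl.
by split; apply: tor_zero_eq => // x; split=> /e.
Qed.

(** Dimension shifting along the flat resolution: in the step, the kernel of d i is the
    image of d (i + 1), which is zero for i = n. *)
Lemma tor_zero_of_flat_dim_le n (M : rmodType R) :
  flat_dim_le n M -> tor_zero n.+1 (full_submod M) (zero_submod M).
Proof.
move=> [F [d [e [Fflat F0 e_onto exact0 exactS]]]].
have step k (A B : rmodType R) (f : {linear A -> B}) : flat A ->
    tor_zero k (ker_submod f) (zero_submod A) -> tor_zero k.+1 (image_submod f) (zero_submod B).
  move=> flatA t; rewrite -tor_zero_image.
  by apply: tor_zero_quotient => //; apply: flat_tor_zero.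
have syzygy k i : (i + k = n)%N -> tor_zero k (image_submod (d i)) (zero_submod (F i)).
  elim: k i => [|k IH] i ik.
    rewrite addn0 in ik; apply: tor_zero_trivial => _ [x _ <-].
    by rewrite (F0 i.+1 _ x) ?linear0 // ik.
  have exS x : range (d i.+1) x <-> d i x = 0 by rewrite exactS.
  by apply: step => //; apply: tor_zero_eq (IH i.+1 _); rewrite // addSnnS.
have ex0 x : range (d 0%N) x <-> e x = 0 by rewrite exact0.
have ontoE x : range e x <-> [set: M] x by rewrite e_onto.
have : tor_zero n.+1 (image_submod e) (zero_submod M).
  by apply: step => //; apply: tor_zero_eq (syzygy n 0%N (add0n n)).
exact: tor_zero_eq.
Qed.

Lemma flat_dim_le0 (M : rmodType R) : flat M -> flat_dim_le 0 M.
Proof.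
move=> flatM; pose Z : rmodType R := submod_type (zero_submod M).
have Z0 (z : Z) : z = 0 by apply: submod_incl_inj; rewrite linear0; exact: (submod_inclP z).
have flatZ : flat Z.
  by apply: flat_of_tor_zero; apply: tor_zero_trivial.
have nullL (A B : rmodType R) : linear (fun _ : A => 0 : B) by move=> r x y; rewrite scaler0 addr0.
exists (fun i => if i is _.+1 then Z else M), (fun i => lin_of (@nullL _ _)).
exists (lin_of (f := fun x : M => x) (fun r x y => erefl)); split=> [[|i] //|[|i] //||| i].
- by apply/seteqP; split=> // x _; exists x.
- by apply/seteqP; split=> [_ [x _ <-]|x /= ->] //; exists 0.
- by apply/seteqP; split=> [_ [x _ <-]|x _] //; exists 0 => //; rewrite /= [RHS]Z0.
Qed.

(** The kernel of a free cover of M satisfies the hypothesis in one degree less, and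
    its flat resolution is extended by the cover. *)
Lemma flat_dim_le_tor_zero n (M : rmodType R) :
  tor_zero n.+1 (full_submod M) (zero_submod M) -> flat_dim_le n M.
Proof.
elim: n M => [|n IH] M tM; first by apply/flat_dim_le0/flat_of_tor_zero.
pose P : rmodType R := fs M (R^c)^o.
pose e : {linear P -> M} := free_cover M.
have e_onto : range e = [set: M].
  by apply/seteqP; split=> // x _; exists (single x (1 : (R^c)^o)) => //; apply: free_cover_single.
have tK : tor_zero n.+1 (full_submod (submod_type (ker_submod e))) (zero_submod _).
  apply/tor_zero_submod_type/(@tor_zero_sub _ _ _ (full_submod P)) => //.
    apply/tor_zero_image; apply: tor_zero_eq tM => // x.
    have ontoE : range e x <-> [set: M] x by rewrite e_onto.
    by split=> /ontoE.
  exact: tor_zero_free.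
have [F [d [e' [Fflat F0 e'_onto exact0 exactS]]]] := IH _ tK.
have compL : linear (fun x => submod_inclL (ker_submod e) (e' x)) by move=> r x y; rewrite !linearP.
pose F' i : rmodType R := if i is i.+1 then F i else P.
pose d' i : {linear F' i.+1 -> F' i} :=
  match i return {linear F' i.+1 -> F' i} with 0%N => lin_of compL | i.+1 => d i end.
have P_flat : flat P by apply: flat_of_tor_zero; apply: tor_zero_free.
exists F', d', e; split=> [[|i]|[//|i]||| [|i]].
- exact: P_flat.
- exact: Fflat.
- exact: F0.
- exact: e_onto.
- apply/seteqP; split=> [_ [x _ <-]|x ex]; first exact: (submod_inclP (e' x)).
  have [z _ hz] : range (submod_inclL (ker_submod e)) x by rewrite range_submod_incl.
  have [y _ hy] : range e' z by rewrite e'_onto.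
  exists y => //; rewrite -hz -hy; exact: erefl.
- rewrite /= exact0; apply/seteqP; split=> x h.
    by apply: etrans (linear0 (submod_inclL (ker_submod e))); congr (submod_inclL _ _); exact: h.
  apply: submod_incl_inj; rewrite linear0; exact: h.
- exact: exactS.
Qed.

Lemma flat_dim_leP n (M : rmodType R) :
  flat_dim_le n M <-> tor_zero n.+1 (full_submod M) (zero_submod M).
Proof. by split; [exact: tor_zero_of_flat_dim_le|exact: flat_dim_le_tor_zero]. Qed.

End FlatDimensionTor.

(** * Relatively pure hulls *)

Section PureHull.
Variables (R : pzRingType) (N : rmodType R) (U : submod N) (T : Type) (leaf : T -> N).

Definition solves m k (a : 'I_m -> 'I_k -> R^c) (c : 'I_m -> N) (x : 'I_k -> N) : Prop :=
  forall i, U (\sum_(j < k) a i j *: x j - c i).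

(** A chosen solution, indexed by natural numbers so that the index can be stored in
    the label of a term. *)
Definition solution m k (a : 'I_m -> 'I_k -> R^c) (c : 'I_m -> N) (j : nat) : N :=
  if pselect (exists x, solves a c x) is left h then
    if insub j is Some j' then sval (cid h) j' else 0
  else 0.

Lemma solutionP m k (a : 'I_m -> 'I_k -> R^c) c : (exists x, solves a c x) ->
  solves a c (fun j => solution a c j).
Proof.
rewrite /solution; case: pselect => // h _.
suff -> : (fun j : 'I_k => if insub (val j) is Some j' then sval (cid h) j' else 0) = sval (cid h).
  by case: cid.
by apply: functional_extensionality => j; rewrite valK.
Qed.

(** Skolem terms. The leaves are generators and coefficients. A node with label
    e + 1 stands for one component of the solution of a system, where e encodes the
    size of the system and the component; it has one child for each equation. The
    child for an equation is a node with label 0, whose children are the right-hand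
    side and the coefficients. The value of such a node is that of its right-hand
    side. *)
Notation term := (GenTree.tree (T + R)).

Definition term_coef (t : term) : R^c := if t is GenTree.Leaf (inr r) then r else 0.

Definition term_row_coef (t : term) (j : nat) : R^c :=
  if t is GenTree.Node _ f then term_coef (nth (GenTree.Node 0 [::]) f j.+1) else 0.

Fixpoint eval (t : term) : N :=
  match t with
  | GenTree.Leaf (inl x) => leaf x
  | GenTree.Leaf (inr _) => 0
  | GenTree.Node 0 f => head 0 (map eval f)
  | GenTree.Node e.+1 f =>
      if unpickle e is Some (m, k, j) then
        @solution m k (fun i l => term_row_coef (nth (GenTree.Node 0 [::]) f i) l)
          (fun i => nth 0 (map eval f) i) j
      else 0
  end.

Lemma eval_solution m k (a : 'I_m -> 'I_k -> R^c) (t : 'I_m -> term) (j : nat) :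
  exists s, eval s = solution a (fun i => eval (t i)) j.
Proof.
pose row i : term :=
  GenTree.Node 0 (t i :: [seq GenTree.Leaf (inr (a i l : R)) | l <- enum 'I_k]).
exists (GenTree.Node (pickle (m, k, j)).+1 [seq row i | i <- enum 'I_m]).
rewrite /= pickleK /=; congr (@solution m k _ _ j).
  apply: functional_extensionality => i; apply: functional_extensionality => l.
  rewrite (nth_map i) ?size_enum_ord // nth_ord_enum /= (nth_map l) ?size_enum_ord //.
  by rewrite nth_ord_enum.
apply: functional_extensionality => i.
by rewrite -map_comp (nth_map i) ?size_enum_ord // nth_ord_enum.
Qed.

(** Values of terms are closed under solving systems modulo U. This alone makes their
    sum with U a submodule, since linear combinations are solutions of systems. *)
Definition hull : set N := [set y | exists u t, U u /\ y = u + eval t].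

Lemma hull_eval t : hull (eval t).
Proof. by exists 0, t; rewrite add0r; case: (submodP U). Qed.

Lemma hull_base u : U u -> hull u.
Proof. by exists u, (GenTree.Node 0 [::]); rewrite addr0. Qed.

Lemma hull_solution m k (a : 'I_m -> 'I_k -> R^c) (c : 'I_m -> N) :
  (forall i, hull (c i)) -> (exists x, solves a c x) ->
  exists t : 'I_k -> term, solves a c (eval \o t).
Proof.
move=> hc [x hx].
have /choice[t /choice[u /all_and2[Uu ct]]] : forall i, exists t u, U u /\ c i = u + eval t.
  by move=> i; have [u [t h]] := hc i; exists t, u.
have sE z : solves a (fun i => eval (t i)) z <-> solves a c z.
  split=> h i; have := h i; rewrite ct opprD addrCA => hi; last first.
    by rewrite -[X in U X](addNKr (u i)); apply: submodD.
  by apply: submodD => //; apply: submod_opp.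
have /choice[s hs] := eval_solution a t.
exists (fun j => s j); apply/sE => i.
have := solutionP (ex_intro _ x (iffRL (sE x) hx)) i.
by congr (U (_ - _)); apply: eq_bigr => j _; rewrite /= hs.
Qed.

Lemma hull_closed : hull 0 /\
  forall (r : R^c) x y, hull x -> hull y -> hull (r *: x + y).
Proof.
split=> [|r x y hx hy]; first by apply: hull_base; case: (submodP U).
(* unknowns z, z1, z2 and equations z1 = x, z2 = y, z - r z1 - z2 = 0 *)
pose a (i j : 'I_3) : R^c :=
  nth 0 (nth [::] [:: [:: 0; 1; 0]; [:: 0; 0; 1]; [:: 1; - r; - 1]] i) j.
pose c (i : 'I_3) := nth 0 [:: x; y; 0] i.
have h0 : hull 0 by apply: hull_base; case: (submodP U).
have [||t ht] := @hull_solution 3 3 a c.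
- by move=> [[|[|[|//]]] i].
- exists (fun j => nth 0 [:: r *: x + y; x; y] j) => i.
  suff -> : \sum_(j < 3) a i j *: nth 0 [:: r *: x + y; x; y] j - c i = 0 by case: (submodP U).
  rewrite !big_ord_recl big_ord0 /a /c; case: i => [[|[|[|//]]] i] /=;
    rewrite ?scale0r ?scale1r ?add0r ?addr0 ?subrr //.
  by rewrite scaleN1r scaleNr -opprD subrr subr0.
have := (ht (inord 0), ht (inord 1), ht (inord 2)).
rewrite /a /c !inordK // !big_ord_recl !big_ord0 /=.
rewrite !scale0r !scale1r !add0r !addr0 subr0 scaleN1r scaleNr.
set z1 := eval (t _); set z2 := eval (t _); set z := eval (t _).
move=> [[h1 h2] h3].
exists (r *: x + y - z), (t ord0); split; last by rewrite -/z subrK.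
rewrite -[_ - _]opprK; apply: submod_opp.
have -> : - (r *: x + y - z) = (z + (- (r *: z1) - z2)) + (r *: (z1 - x) + (z2 - y)).
  by rewrite scalerBr opprB -[RHS]addrA (addrACA (r *: z1)) -!opprD addKr.
by apply: submodD => //; apply: submodD => //; apply: submodZ.
Qed.

Definition pure_hull : submod N := Submod hull_closed.

Lemma pure_hull_relatively_pure : relatively_pure U pure_hull.
Proof.
move=> m k a c hc hx; have [t ht] := hull_solution hc hx.
by exists (eval \o t) => // j; apply: hull_eval.
Qed.

End PureHull.

(** * The three classes of embeddings *)

Section EmbeddingClasses.
Variable R : pzRingType.

(** What the count of types uses of each class of embeddings, described by the
    property P that an embedding imposes on its image. *)
Record inherited_by_hulls (P : forall N : rmodType R, set N -> Prop) : Prop := InheritedByHulls {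
  inherited_zero : forall N, P N [set 0];
  inherited_hull : forall N (U Y : submod N), (forall x, U x -> Y x) ->
    relatively_pure U Y -> P N U -> P N Y }.

Lemma embedding_inherited : inherited_by_hulls (fun _ _ => True).
Proof. by []. Qed.

(** A solution in Y modulo U is corrected by an element of U, which exists because
    U is an RD-submodule; likewise for pure submodules. *)
Lemma RD_inherited : inherited_by_hulls (@RD_sub R).
Proof.
split=> [N r|N U Y UY pY RDU r].
  apply/seteqP; split=> [x [/= -> _]|_ [x /= -> <-]]; first by exists 0; rewrite ?scaler0.
  by rewrite scaler0; split=> //; exists 0; rewrite ?scaler0.
apply/seteqP; split=> [z [Yz [x _ xz]]|_ [x Yx <-]]; last first.
  by split; [exact: submodZ|exists x].
rewrite -{z}xz in Yz *.
have E z : \sum_(j < 1) (fun _ _ : 'I_1 => r) ord0 j *: (z : 'I_1 -> N) j = r *: z ord0.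
  by rewrite big_ord_recl big_ord0 addr0.
have [//||y Yy hy] := pY 1%N 1%N (fun _ _ => r) (fun=> r *: x).
  by exists (fun=> x) => i; rewrite E subrr; case: (submodP U).
have {hy} := hy ord0; rewrite E -scalerBr => hy.
have : (submod_set U `&` range (fun x : N => r *: x)) (r *: (y ord0 - x)).
  by split=> //; exists (y ord0 - x).
rewrite RDU => -[u Uu hu]; exists (y ord0 - u); first by apply: submodB => //; apply: UY.
by rewrite scalerBr hu scalerBr opprB addrC subrK.
Qed.

Lemma pure_inherited : inherited_by_hulls (@pure_sub R).
Proof.
split=> [N m k a c /= c0 _|N U Y UY pY pU m k a c Yc [x hx]].
  by exists (fun=> 0) => // i; rewrite c0 big1 // => j _; rewrite scaler0.
have [|y Yy hy] := pY _ _ a _ Yc.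
  by exists x => i; rewrite hx subrr; case: (submodP U).
have [|u Uu hu] := pU _ _ a _ hy.
  exists (fun j => y j - x j) => i; rewrite -hx -sumrB.
  by apply: eq_bigr => j _; rewrite scalerBr.
exists (fun j => y j - u j) => [j|i]; first by apply: submodB => //; apply: UY.
under eq_bigr do rewrite scalerBr.
by rewrite sumrB hu opprB addrC subrK.
Qed.

End EmbeddingClasses.

(** * Stability *)

Section Stability.
Variables (R : pzRingType) (n : nat).
Variable mor : forall M N : rmodType R, {linear M -> N} -> Prop.
Variable P : forall N : rmodType R, set N -> Prop.
Hypothesis morE : forall (M N : rmodType R) (f : {linear M -> N}),
  mor f <-> injective f /\ P (range f).
Hypothesis inhP : inherited_by_hulls P.

Local Notation cls := (@flat_dim_le R n).

Lemma inherited_full (N : rmodType R) : P [set: N].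
Proof.
have := @inherited_hull _ _ inhP N (zero_submod N) (full_submod N); apply=> //.
  by move=> m k a c _ [x hx]; exists x.
exact: inherited_zero.
Qed.

Lemma A_embedding_id (N : rmodType R) : cls N ->
  A_embedding cls mor (lin_of (f := fun x : N => x) (fun r x y => erefl)).
Proof.
move=> clsN; split=> //; apply/morE; split=> //.
rewrite (_ : range _ = [set: N]); first exact: inherited_full.
by apply/seteqP; split=> // x _; exists x.
Qed.

Lemma flat_dim_hull (N : rmodType R) (U : submod N) (T : Type) (l : T -> N) :
  cls N -> tor_zero n.+1 U (zero_submod N) -> cls (submod_type (pure_hull U l)).
Proof.
rewrite !flat_dim_leP => tN tU; apply/tor_zero_submod_type.
apply: tor_zero_of_relatively_pure tN tU; first exact: hull_base.
exact: pure_hull_relatively_pure.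
Qed.

Lemma P_hull (N : rmodType R) (U : submod N) (T : Type) (l : T -> N) :
  P (submod_set U) -> P (submod_set (pure_hull U l)).
Proof.
apply: (inherited_hull inhP); first exact: hull_base.
exact: pure_hull_relatively_pure.
Qed.

Let kappa : card_type := (R + nat)%type.

Lemma embeds_nat_kappa : embeds nat kappa.
Proof. by exists inr => i j []. Qed.

(** The pure hull of A has at most as many elements as there are terms over A and R. *)
Lemma LS_bound_kappa : LS_bound cls mor kappa.
Proof.
split; first by apply/infinite_embeds/embeds_nat_kappa.
  by apply/embeds_card_le; exists inl => x y [].
move=> B A clsB _; pose l (x : A) : B := val x.
pose Y := pure_hull (zero_submod B) l.
exists (submod_type Y), (submod_inclL Y); split.
- split=> //; first by apply: flat_dim_hull => //; apply: tor_zero_trivial.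
  apply/morE; split; first exact: submod_incl_inj.
  by rewrite range_submod_incl; apply/P_hull/(inherited_zero inhP).
- rewrite range_submod_incl => x Ax.
  exact: (hull_eval (zero_submod B) l (GenTree.Leaf (inl (SigSub (mem_set Ax))))).
apply/embeds_card_le/(@embeds_trans (GenTree.tree (A + R))).
  have /choice[t ht] : forall y : submod_type Y, exists t,
      submod_inclL Y y = eval (zero_submod B) l t.
    by move=> y; have [u [t [-> ->]]] := submod_inclP y; exists t; rewrite add0r.
  by exists t => x y e; apply: submod_incl_inj; rewrite !ht e.
apply: embeds_tree; first by exists (inr \o inr) => i j [].
by apply: embeds_sum; [exact: embeds_refl|exists inl => x y []].
Qed.

Lemma is_LS_kappa : is_LS cls mor kappa.
Proof.
split=> [|L [infL RL _]]; first exact: LS_bound_kappa.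
move/infinite_embeds in infL; move/embeds_card_le in RL.
exact/embeds_card_le/embeds_add.
Qed.

Section Types.
Variable M : rmodType R.
Local Notation term := (GenTree.tree (unit + R)).
Local Notation code := (R * term * term * term -> option M)%type.

Definition type_hull (t : triple cls unit M) : submod (tr_mod t) :=
  pure_hull (image_submod (tr_incl t)) (tr_tuple t).

Definition ev (t : triple cls unit M) : term -> tr_mod t :=
  eval (image_submod (tr_incl t)) (tr_tuple t).

(** These relations modulo M determine the module structure of the hull over M; the
    scalar 0 gives the equalities modulo M. *)
Definition has_code (t : triple cls unit M) (c : code) : Prop :=
  forall r w w1 w2 m, c (r, w, w1, w2) = Some m <->
    (r : R^c) *: ev t w + ev t w1 - ev t w2 = tr_incl t m.

Lemma exists_code t : exists c, has_code t c.
Proof.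
have /choice[c hc] : forall q : R * term * term * term, exists o : option M, forall m,
    o = Some m <-> (q.1.1.1 : R^c) *: ev t q.1.1.2 + ev t q.1.2 - ev t q.2 = tr_incl t m.
  move=> q; set x := _ + _ - _.
  have [[m hm]|nm] := pselect (exists m, x = tr_incl t m).
    by exists (Some m) => m'; split=> [[<-]|]; rewrite ?hm // => /tr_inj ->.
  by exists None => m; split=> // hm; case: nm; exists m.
by exists c => r w w1 w2 m; exact: (hc (r, w, w1, w2)).
Qed.

Lemma cls_type_hull t : cls M -> cls (submod_type (type_hull t)).
Proof.
move=> clsM; apply: flat_dim_hull; first exact: tr_cls.
exact/(tor_zero_injective _ (@tr_inj _ _ _ _ t))/flat_dim_leP.
Qed.

Lemma A_embedding_hull t : A_embedding cls mor (tr_incl t) ->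
  A_embedding cls mor (submod_inclL (type_hull t)).
Proof.
move=> [clsM clsN iI /morE[_ Pi]]; split=> //; first exact: cls_type_hull.
apply/morE; split; first exact: submod_incl_inj.
by rewrite range_submod_incl; apply: P_hull.
Qed.

(** The elements i m + w of the hull Y of M and b in N correspond to the elements
    i' m + w of the hull in N', for m in M and w a term: equal codes say that this is
    well defined, linear and injective. So Y embeds in N as well as in N', over M and
    b. *)
Lemma same_code_type_equiv (t t' : triple cls unit M) (c : code) :
  A_embedding cls mor (tr_incl t) -> A_embedding cls mor (tr_incl t') ->
  has_code t c -> has_code t' c -> type_equiv mor t t'.
Proof.
move=> At At' ct ct'; have [clsM clsN iI _] := At; have [_ clsN' iI' /morE[_ Pi']] := At'.
set i := tr_incl t in At iI *; set i' := tr_incl t' in At' iI' Pi' *.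
set Y := type_hull t; set Y' := type_hull t'.
have iY m : Y (i m) by apply: hull_base; exists m.
have bY u : Y (tr_tuple t u) by exact: (hull_eval _ (tr_tuple t) (GenTree.Leaf (inl u))).
pose s : triple cls unit M := Triple (cls_type_hull t clsM)
  (tr_incl := corestr (f := i) iY)
  (fun x y h => iI x y (congr1 (submod_inclL Y) h))
  (fun u => in_submod (bY u)).
have transfer r w w1 w2 m :
    (r : R^c) *: ev t w + ev t w1 - ev t w2 = i m <->
    (r : R^c) *: ev t' w + ev t' w1 - ev t' w2 = i' m.
  by rewrite -ct -ct'.
have transfer_eq m w m1 w1 : i m + ev t w = i m1 + ev t w1 <->
    i' m + ev t' w = i' m1 + ev t' w1.
  have E (N : rmodType R) (f : {linear M -> N}) (x y : N) :
      f m + x = f m1 + y <-> (0 : R^c) *: x + x - y = f (m1 - m).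
    rewrite scale0r add0r linearB; split=> h.
      by apply/eqP; rewrite subr_eq addrAC -h addrAC subrr add0r.
    by rewrite -[x](subrK y) h addrA (addrC (f m)) subrK.
  by rewrite !E; exact: transfer.
have /choice[q hq] : forall y : submod_type Y, exists p : M * term,
    submod_inclL Y y = i p.1 + ev t p.2.
  by move=> y; have [_ [w [[m _ <-] ->]]] := submod_inclP y; exists (m, w).
pose psi y := i' (q y).1 + ev t' (q y).2.
have psiE y m w : submod_inclL Y y = i m + ev t w -> psi y = i' m + ev t' w.
  by move=> h; apply/transfer_eq; rewrite -hq.
have psi_linear : linear psi.
  move=> r x y; rewrite /psi; set m1 := (q x).1; set w1 := (q x).2.
  set m2 := (q y).1; set w2 := (q y).2; set m := (q _).1; set w := (q _).2.
  have E (N : rmodType R) (f : {linear M -> N}) (a b z : N) :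
      f m + z = r *: (f m1 + a) + (f m2 + b) <-> r *: a + b - z = f (m - r *: m1 - m2).
    rewrite !linearB linearZ /= scalerDr addrACA; split=> h; last first.
      rewrite -[r *: a + b](subrK z) h addrA; congr (_ + _).
      by rewrite -(addrA (f m)) -opprD [RHS]addrC subrK.
    by apply/eqP; rewrite subr_eq -(addrA (f m)) -opprD addrAC h (addrC (r *: f m1 + f m2)) addrK.
  apply/E/transfer/E; rewrite -!hq; exact: linearP.
pose f := lin_of psi_linear.
have f_inj : injective f.
  by move=> x y /transfer_eq; rewrite -!hq => /submod_incl_inj.
have f_range : range f = submod_set Y'.
  apply/seteqP; split=> [_ [y _ <-]|_ [_ [w [[m _ <-] ->]]]].
    by exists (i' (q y).1), (q y).2; split=> //; exists (q y).1.
  have Yy : Y (i m + ev t w) by exists (i m), w; split=> //; exists m.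
  by exists (in_submod Yy) => //; apply: psiE.
have At_s : atomically_related mor t s.
  exists (tr_mod t), (lin_of (f := fun x : tr_mod t => x) (fun r x y => erefl)), (submod_inclL Y).
  by split=> //; [exact: A_embedding_id|exact: A_embedding_hull].
have As_t' : atomically_related mor s t'.
  exists (tr_mod t'), f, (lin_of (f := fun x : tr_mod t' => x) (fun r x y => erefl)).
  split; [|exact: A_embedding_id| |].
  - split=> //; first exact: cls_type_hull.
    by apply/morE; split=> //; rewrite f_range; apply: P_hull.
  - move=> m; transitivity (i' m + ev t' (GenTree.Node 0 [::])); last exact: addr0.
    by apply: psiE; rewrite corestrE [RHS]addr0.
  - move=> u; transitivity (i' 0 + ev t' (GenTree.Leaf (inl u))); last first.
      by rewrite linear0; exact: add0r.
    by apply: psiE; rewrite linear0 [RHS]add0r.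
exact: t_trans (t_step _ _ _ _ At_s) (t_step _ _ _ _ As_t').
Qed.

Lemma same_code_gtp (t t' : triple cls unit M) (c : code) :
  A_embedding cls mor (tr_incl t) -> A_embedding cls mor (tr_incl t') ->
  has_code t c -> has_code t' c -> gtp mor t = gtp mor t'.
Proof.
move=> At At' ct ct'; apply: functional_extensionality => s; apply/propext.
split; apply: t_trans.
  exact: same_code_type_equiv At' At ct' ct.
exact: same_code_type_equiv At At' ct ct'.
Qed.

End Types.

Let L : card_type := kappa -> bool.

(** The number of codes is at most (2 ^ kappa + 1) ^ kappa = 2 ^ kappa. *)
Lemma stable_in_powerset : stable_in cls mor L.
Proof.
move=> M clsM ML.
have natK := embeds_nat_kappa.
have RK : embeds R kappa by exists inl => x y [].
have treeK : embeds (GenTree.tree (unit + R)) kappa.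
  apply: embeds_tree => //; apply: embeds_add => //.
  by exists (fun=> inr 0%N) => -[] [].
have ML' : embeds M (kappa -> bool).
  by apply/embeds_card_le; move/card_eqPle: ML => [].
set term := GenTree.tree (unit + R) in treeK.
have [h hI] : embeds (R * term * term * term -> option M) L.
  apply: (embeds_trans (embeds_fun_option _ ML')); apply: embeds_powerset.
  have prodK A B : embeds A kappa -> embeds B kappa -> embeds (A * B) kappa.
    by move=> AK BK; apply: embeds_trans (embeds_prod AK BK) (embeds_square natK).
  apply: (prodK); first by do !apply: (prodK).
  apply: (@embeds_trans (kappa + unit)).
    by exists (fun o => if o is Some x then inl x else inr tt) => -[x|] [y|] // [->].
  apply: embeds_add => //; first exact: embeds_refl.
  by exists (fun=> inr 0%N) => -[] [].
have code_of (p : triple cls unit M -> Prop) : exists l : L, gS mor p ->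
    exists t c, [/\ A_embedding cls mor (tr_incl t), p = gtp mor t, has_code t c & l = h c].
  have [[t At pt]|np] := pselect (gS mor p); last by exists (fun=> false).
  by have [c hc] := exists_code t; exists (h c) => _; exists t, c.
exists (fun p => sval (cid (code_of p))) => p q gp gq.
case: cid => l /= /(_ gp) [t [c [At -> ct ->]]].
case: cid => l' /= /(_ gq) [t' [c' [At' -> ct' ->]]] /hI cc'.
by apply: same_code_gtp At At' ct _; rewrite cc'.
Qed.

Lemma stable_flat_dim : stable cls mor.
Proof.
exists kappa, L; split; [exact: is_LS_kappa| |exact: stable_in_powerset].
apply/embeds_card_le; exists (fun x y => `[< x = y >]) => x y /(congr1 (@^~ y)) /=.
by rewrite [in RHS](asboolT (erefl y)) => /asboolP.
Qed.

End Stability.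

Theorem corollary3p19 (R : pzRingType) (n : nat)
    (mor : forall M N : rmodType R, {linear M -> N} -> Prop)
    (hmor : mor = @embedding R \/ mor = @RD_embedding R
            \/ mor = @pure_embedding R) :
  stable (@flat_dim_le R n) mor.
Proof.
case: hmor => [->|[->|->]].
- apply: (stable_flat_dim _ _ (embedding_inherited R)) => M N f.
  by split=> [|[]].
- exact: (stable_flat_dim _ _ (RD_inherited R)).
- exact: (stable_flat_dim _ _ (pure_inherited R)).
Qed.
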